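(* Let $0<q<1$. The measure ${}_q\mathbb{P}_{N,\nu}$ on interlacing particle arrays $\{\mathsf{x}^m_j: m=1,\dots,N,\ j=1,\dots,m\}$ with fixed top row $\mathsf{x}^N_j=\nu_j-j$ ($j=1,\dots,N$) is determinantal with correlation kernel given for $1\le n_1\le N$, $1\le n_2\le N-1$ and $x_1,x_2\in\mathbb{Z}$ by $${}_qK(x_1,n_1;x_2,n_2)=-1_{n_2<n_1}1_{x_2\le x_1}q^{n_2(x_1-x_2)}\frac{(q^{x_1-x_2+1};q)_{n_1-n_2-1}}{(q;q)_{n_1-n_2-1}}$$ $$+\frac{(q^{N-1};q^{-1})_{N-n_1}}{(2\pi\mathrm{i})^2}\oint_{\mathfrak{C}_q(x_2-x_1)}dz\oint_{\mathfrak{c}(\infty)}\frac{dw}{w}\,\frac{q^{n_2(x_1-x_2)}z^{n_2}}{w-z}\;{}_2\phi_1(q^{-1},q^{n_1-1};q^{N-1}\mid q^{-1};w^{-1})$$ $$\times\frac{(zq^{1-x_2+x_1};q)_{N-n_2-1}}{(q;q)_{N-n_2-1}}\prod_{r=1}^N\frac{w-q^{\nu_r-r-x_1}}{z-q^{\nu_r-r-x_1}} .$$ The contours in $z$ and $w$ are counter-clockwise and do not intersect. The contour $\mathfrak{C}_q(x_2-x_1)$ in $z$ encircles the points $q^{x_2-x_1},q^{x_2-x_1+1},\dots,q^{\nu_1-1-x_1}$ and only them (i.e. it does not contain $q^{x_2-x_1-1},q^{x_2-x_1-2},\dots$). The contour $\mathfrak{c}(\infty)$ in $w$ is sufficiently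 large and contains $\mathfrak{C}_q(x_2-x_1)$.
   Context: Fix $\nu=(\nu_1\ge\dots\ge\nu_N)\in\mathbb{Z}^N$. A Gelfand-Tsetlin scheme with top row $\nu$ is a sequence $\nu^{(1)}\prec\nu^{(2)}\prec\dots\prec\nu^{(N)}=\nu$, where $\nu^{(m)}=(\nu^{(m)}_1\ge\dots\ge\nu^{(m)}_m)\in\mathbb{Z}^m$ and $\nu^{(m-1)}\prec\nu^{(m)}$ means $\nu^{(m)}_1\ge\nu^{(m-1)}_1\ge\nu^{(m)}_2\ge\dots\ge\nu^{(m-1)}_{m-1}\ge\nu^{(m)}_m$. Its volume is $\mathsf{vol}=\sum_{m=1}^{N-1}|\nu^{(m)}|$, $|\nu^{(m)}|=\sum_j\nu^{(m)}_j$. The measure ${}_q\mathbb{P}_{N,\nu}$ is the probability measure on such schemes with weights proportional to $q^{-\mathsf{vol}}$. Schemes are identified with interlacing arrays by $\mathsf{x}^m_j=\nu^{(m)}_j-j$ (so $\mathsf{x}^m_{j+1}<\mathsf{x}^{m-1}_j\le\mathsf{x}^m_j$). ''Correlation kernel'' means: for pairwise distinct $(x_i,n_i)$, $x_i\in\mathbb{Z}$, $1\le n_i\le N-1$, $i=1,\dots,s$, the probability that every $(x_i,n_i)$ is of the form $(\mathsf{x}^{m}_j,m)$ equals $\det[{}_qK(x_i,n_i;x_j,n_j)]_{i,j=1}^s$. Notation: $(a;p)_0=1$, $(a;p)_m=\prod_{i=0}^{m-1}(1-ap^i)$; ${}_2\phi_1(a,b;c\mid p;y)=\sum_{i\ge0}\frac{(a;p)_i(b;p)_i}{(c;p)_i}\frac{y^i}{(p;p)_i}$.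 In the formula above the series terminates because of $(q^{n_1-1};q^{-1})_i$: it is the sum over $0\le i\le n_1-1$. $1_{\{\cdot\}}$ is an indicator; the first summand is $0$ if $n_2\ge n_1$. *)

(* Defs.v *)
From HB Require Import structures.
From mathcomp Require Import all_boot all_order all_algebra.
From mathcomp Require Import complex.
From mathcomp Require Import all_classical all_reals all_analysis.

Set Implicit Arguments.
Unset Strict Implicit.
Unset Printing Implicit Defensive.

Import Order.TTheory GRing.Theory Num.Theory.
Import numFieldNormedType.Exports.

Local Open Scope classical_set_scope.
Local Open Scope ring_scope.

(** * Gelfand-Tsetlin schemes and their q-weighted measure *)

(* Sequences are 0-based: [l`_j] is the part of index j+1. *)

Definition signature (m : nat) (l : seq int) : Prop :=
  size l = m /\ sorted >=%R l.

(* [interlace mu la] is  mu \prec la. *)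
Definition interlace (mu la : seq int) : Prop :=
  forall j : nat, (j < size mu)%N -> la`_j.+1 <= mu`_j <= la`_j.

Definition array (N : nat) := N.-tuple (seq int).

(* nu^(m), for 1 <= m <= N *)
Definition level (N : nat) (s : array N) (m : nat) : seq int :=
  nth [::] s m.-1.

Definition GT_scheme (N : nat) (nu : N.-tuple int) : set (array N) :=
  [set s | [/\ forall m, (1 <= m <= N)%N -> signature m (level s m),
               forall m, (2 <= m <= N)%N -> interlace (level s m.-1) (level s m)
             & level s N = nu]].

Definition vol (N : nat) (s : array N) : int :=
  \sum_(1 <= m < N) \sum_(a <- level s m) a.

Definition weight (R : realType) (q : R) (N : nat) (s : array N) : R :=
  q ^ (- vol s).

(* [\sum_(s \in A)] is the finitely supported sum; [GT_scheme nu] is finite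
   because all parts lie between nu_N and nu_1. *)
Definition qprob (R : realType) (q : R) (N : nat) (nu : N.-tuple int)
    (E : set (array N)) : R :=
  (\sum_(s \in GT_scheme nu `&` E) weight q s) /
  (\sum_(s \in GT_scheme nu) weight q s).

(* (x, m) is one of the particles x^m_j = nu^(m)_j - j, 1 <= j <= m. *)
Definition occupied (N : nat) (s : array N) (x : int) (m : nat) : Prop :=
  exists2 j : nat, (j < m)%N & x = (level s m)`_j - j.+1%:Z.

Definition correlation_kernel (R : realType) (q : R) (N : nat)
    (nu : N.-tuple int) (K : int -> nat -> int -> nat -> R[i]) : Prop :=
  forall (s : nat) (x : 'I_s -> int) (n : 'I_s -> nat),
    injective (fun i => (x i, n i)) ->
    (forall i, (1 <= n i <= N - 1)%N) ->
    ((qprob q nu [set a | forall i, occupied a (x i) (n i)])%:C)%C =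
    \det (\matrix_(i < s, j < s) K (x i) (n i) (x j) (n j)).

(** * Contour integrals *)

(* Paths are parametrized by [0, 1]; values outside [0, 1] are irrelevant. *)

Definition C1 (R : realType) (f : R -> R) : Prop :=
  (forall t, derivable f t 1) /\ continuous (derive1 f).

Definition piecewise_C1 (R : realType) (g : R -> R[i]) : Prop :=
  exists (n : nat) (t : nat -> R),
    [/\ t 0%N = 0, t n = 1, forall i, (i < n)%N -> t i < t i.+1
      & forall i, (i < n)%N -> exists h : R -> R[i],
          [/\ C1 (fun u => complex.Re (h u)), C1 (fun u => complex.Im (h u))
            & forall u, t i <= u <= t i.+1 -> g u = h u]].

Definition path_deriv (R : realType) (g : R -> R[i]) (t : R) : R[i] :=
  Complex (derive1 (fun u => complex.Re (g u)) t)
          (derive1 (fun u => complex.Im (g u)) t).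

(* At the end points and the finitely many break points, [path_deriv g] is junk,
   which does not affect the Lebesgue integral. *)
Definition contour_integral (R : realType) (g : R -> R[i]) (f : R[i] -> R[i])
    : R[i] :=
  Complex
    (\int[@lebesgue_measure R]_(t in `[0, 1]) complex.Re (f (g t) * path_deriv g t))
    (\int[@lebesgue_measure R]_(t in `[0, 1]) complex.Im (f (g t) * path_deriv g t)).

Definition twopii (R : realType) : R[i] := Complex 0 (2 * pi).

Definition winding (R : realType) (g : R -> R[i]) (a : R[i]) : R[i] :=
  (twopii R)^-1 * contour_integral g (fun z => (z - a)^-1).

Definition off_path (R : realType) (g : R -> R[i]) (a : R[i]) : Prop :=
  forall t, 0 <= t <= 1 -> g t != a.

Definition inside (R : realType) (g : R -> R[i]) (a : R[i]) : Prop :=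
  off_path g a /\ winding g a = 1.

Definition outside (R : realType) (g : R -> R[i]) (a : R[i]) : Prop :=
  off_path g a /\ winding g a = 0.

(* A simple closed contour; it is counter-clockwise when no winding number is
   -1, i.e. every point off it has winding number 1 or 0. *)
Definition ccw_contour (R : realType) (g : R -> R[i]) : Prop :=
  [/\ piecewise_C1 g, g 0 = g 1,
      forall t u, 0 <= t < 1 -> 0 <= u < 1 -> g t = g u -> t = u
    & forall a, off_path g a -> inside g a \/ outside g a].

(* gz encircles q^k for x2 - x1 <= k <= nu1 - 1 - x1 and none of the q^k with
   k < x2 - x1.  The points q^k with k > nu1 - 1 - x1, and 0, are not
   singularities of the integrand in z: their position is left free.
   gw is "sufficiently large": it contains gz and the pole w = 0. *)
Definition admissible_contours (R : realType) (q : R) (nu1 x1 x2 : int)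
    (gz gw : R -> R[i]) : Prop :=
  [/\ ccw_contour gz /\ ccw_contour gw,
      forall k : int, x2 - x1 <= k <= nu1 - 1 - x1 -> inside gz (q%:C%C ^ k),
      forall k : int, k < x2 - x1 -> outside gz (q%:C%C ^ k),
      forall t, 0 <= t <= 1 -> inside gw (gz t)
    & inside gw 0].

(** * The kernel *)

(* (a; p)_m *)
Definition qpoch (F : fieldType) (a p : F) (m : nat) : F :=
  \prod_(i < m) (1 - a * p ^+ i).

(* The 2phi1 series truncated to its first n terms; for n = n1 this is the whole
   terminating series with b = q^(n1-1), base q^-1. *)
Definition phi21 (F : fieldType) (n : nat) (a b c p y : F) : F :=
  \sum_(i < n) qpoch a p i * qpoch b p i / qpoch c p i * (y ^+ i / qpoch p p i).

Definition kernel_integrand (R : realType) (q0 : R) (N : nat) (nu : N.-tuple int)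
    (x1 : int) (n1 : nat) (x2 : int) (n2 : nat) (z w : R[i]) : R[i] :=
  let q : R[i] := q0%:C%C in
  w^-1 * (q ^ (n2%:Z * (x1 - x2)) * z ^+ n2 / (w - z))
  * phi21 n1 q^-1 (q ^+ (n1 - 1)) (q ^+ (N - 1)) q^-1 w^-1
  * (qpoch (z * q ^ (1 - x2 + x1)) q (N - n2 - 1) / qpoch q q (N - n2 - 1))
  * \prod_(r < N) ((w - q ^ (tnth nu r - r.+1%:Z - x1)) /
                   (z - q ^ (tnth nu r - r.+1%:Z - x1))).

Definition qkernel (R : realType) (q0 : R) (N : nat) (nu : N.-tuple int)
    (x1 : int) (n1 : nat) (x2 : int) (n2 : nat) (gz gw : R -> R[i]) : R[i] :=
  let q : R[i] := q0%:C%C in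
  - (if (n2 < n1)%N && (x2 <= x1)
     then q ^ (n2%:Z * (x1 - x2))
          * (qpoch (q ^ (x1 - x2 + 1)) q (n1 - n2 - 1) / qpoch q q (n1 - n2 - 1))
     else 0)
  + qpoch (q ^+ (N - 1)) q^-1 (N - n1) / (twopii R) ^+ 2
    * contour_integral gz (fun z =>
        contour_integral gw (fun w =>
          kernel_integrand q0 nu x1 n1 x2 n2 z w)).

(* Main.v *)
(* The law of the lower rows is handled through partition functions with an
   arbitrary weight g_m(y) on the particles.  Given a row, the next lower row
   ranges over a product of independent intervals, so summing row by row turns the
   partition function into det[Psi_i(t_r)], where t_r are the top particles and
   Psi_i is any solution of Psi_i^(m+1)(y) - Psi_i^(m+1)(y - 1) = g_m(y) Psi_i^m(y)
   started from the constant 1.  For g_m(y) = q^(-y) the solutions are powers of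
   q^(-y), and changing g at the points (x_k, n_k) perturbs the determinant by a
   term of finite rank, so the ratio of partition functions is det(1 + T K) by
   Sylvester's identity; inclusion-exclusion over the points gives det K.
   Inverting the unperturbed matrix is Lagrange interpolation at the nodes
   q^(t_r - x1), which is also what the double contour integral computes: the
   integral in w extracts the polynomial part of
   w^-1 phi(1/w) prod_r (w - q^(t_r - x1)), whose value at a node is a combination
   of coefficients of a nodal polynomial, and the integral in z is the sum of the
   residues at the nodes with t_r >= x2.  The two forms of K differ by conjugation
   by q^((n - 1) x).  Integrals of powers vanish by the fundamental theorem of
   calculus, and winding numbers are prescribed by the hypotheses on the contours. *)

Require Import Defs.
From mathcomp Require Import all_boot all_order all_algebra fingroup perm.
From mathcomp Require Import complex ring zify.
From mathcomp Require Import all_classical all_reals all_analysis measurable_realfun.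

Set Implicit Arguments.
Unset Strict Implicit.
Unset Printing Implicit Defensive.

Import Order.TTheory GRing.Theory Num.Theory.
Local Open Scope ring_scope.

(** * Determinants *)

Section Determinants.
Variable F : comUnitRingType.

(** Sylvester's identity for rectangular factors: the same two block matrices, multiplied in either
    order, give block triangular matrices with [1 + B A], respectively [1 + A B], as the only
    nontrivial diagonal block. *)
Lemma det_addC (m n : nat) (A : 'M[F]_(m, n)) (B : 'M[F]_(n, m)) :
  \det (1%:M + A *m B) = \det (1%:M + B *m A).
Proof.
have e1 : block_mx 1%:M (- A) B 1%:M *m block_mx 1%:M A 0 1%:M
  = block_mx 1%:M 0 B (1%:M + B *m A).
  by rewrite mulmx_block !(mulmx1, mul1mx, mulmx0, addr0) subrr addrC.
have e2 : block_mx 1%:M A 0 1%:M *m block_mx 1%:M (- A) B 1%:M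
  = block_mx (1%:M + A *m B) 0 B 1%:M.
  by rewrite mulmx_block !(mulmx1, mul1mx, mul0mx, add0r) addNr.
have := congr1 determinant e1; have := congr1 determinant e2.
rewrite !det_mulmx !det_lblock !det_ublock !det1 !mulr1 !mul1r.
by move=> -> ->.
Qed.

(** Multilinearity in the rows: [S] is the set of rows taken from [A]. *)
Lemma det_add_rows (n : nat) (A B : 'M[F]_n) :
  \det (A + B) =
  \sum_(S : {set 'I_n}) \det (\matrix_(i, j) if i \in S then A i j else B i j).
Proof.
rewrite /determinant exchange_big /=; apply: eq_bigr => s _.
rewrite -big_distrr /=; congr (_ * _).
under eq_bigr do rewrite mxE.
rewrite bigA_distr; apply: eq_bigr => S _.
by apply: eq_bigr => i _; rewrite mxE; case: ifP.
Qed.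


(** Expand [K = (K - 1) + 1] by rows; a row of [K - 1] is minus a row of [1 - K]. Each term is a
    determinant of the form [1 + T K] with [T] diagonal, so the expansion can be matched with
    inclusion-exclusion over vacant points. *)
Lemma det_sieve (n : nat) (K : 'M[F]_n) :
  \det K = \sum_(S : {set 'I_n})
    (\prod_(i in S) -1) *
    \det (1%:M + diag_mx (\row_i (if i \in S then -1 else 0)) *m K).
Proof.
have {1}-> : K = (K - 1%:M) + 1%:M by rewrite subrK.
rewrite det_add_rows; apply: eq_bigr => S _.
have -> : \prod_(i in S) -1 =
          \det (diag_mx (\row_i (if i \in S then -1 else 1 : F))).
  rewrite det_diag big_mkcond; apply: eq_bigr => i _; by rewrite mxE.
rewrite -det_mulmx; congr (\det _); apply/matrixP => i j.
rewrite mul_diag_mx mul_diag_mx !mxE.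
case: ifP => iS; rewrite ?mul0r ?addr0 ?mul1r //.
by rewrite !mulN1r opprD opprK addrC.
Qed.

(** [B] is strictly triangular for the grading [f], in which ties are allowed. A permutation
    contributing to the determinant must raise [f] strictly wherever it moves an index. *)
Lemma det_strict (n : nat) (f : 'I_n -> nat) (B : 'M[F]_n) :
  (forall i j, ~~ (f i < f j)%N -> B i j = 0) -> \det (1%:M - B) = 1.
Proof.
move=> hB; rewrite /determinant (bigD1 (1%g : {perm _})) //= [X in _ + X]big1 ?addr0 => [|s s1].
  rewrite odd_perm1 expr0 mul1r big1 // => i _.
  by rewrite perm1 !mxE eqxx hB ?subr0 ?ltnn.
have [h|h] := boolP [forall i, (i == s i) || (f i < f (s i))%N]; last first.
  move: h; rewrite negb_forall => /existsP[i0].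
  move: i0 => i; rewrite negb_or => /andP[ne nlt].
  by rewrite (bigD1 i) //= !mxE (negPf ne) hB // subr0 mul0r mulr0.
have le : forall i, true -> (f i <= f (s i) ?= iff (i == s i))%N.
  move=> i _; move/forallP/(_ i)/orP: h => [/eqP <-|lt].
    by rewrite eqxx; split; rewrite ?eqxx.
  split; first exact: ltnW.
  rewrite ltn_eqF //; apply/esym/negbTE/eqP => e.
  by rewrite -e ltnn in lt.
(* A permutation preserves the total of [f], so equality holds in every [f i <= f (s i)], which
   forces [s] to be the identity. *)
have := leqif_sum le; rewrite [X in (_ <= X ?= iff _)%N](reindex_inj (@perm_inj _ s^-1%g)) /=.
under [X in (_ <= X ?= iff _)%N]eq_bigr do rewrite permKV.
case=> _; rewrite eqxx => /esym/forallP e.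
case/eqP: s1; apply/permP => i; rewrite perm1.
by move: (e i) => /= /eqP.
Qed.

(* Factoring out [G] on the left, so that [G] need not be invertible, and then
   Sylvester's identity [det_addC]. *)
Lemma det_perturb (N s : nat) (G : 'M[F]_N) (E : 'M[F]_(N, s))
    (B T : 'M[F]_s) (C : 'M[F]_(s, N)) :
  \det (1%:M - T *m B) = 1 ->
  \det (G + G *m E *m invmx (1%:M - T *m B) *m T *m C) =
  \det G * \det (1%:M + T *m (C *m E - B)).
Proof.
move=> h.
have u : 1%:M - T *m B \in unitmx by rewrite unitmxE h unitr1.
have -> : G + G *m E *m invmx (1%:M - T *m B) *m T *m C =
   G *m (1%:M + E *m (invmx (1%:M - T *m B) *m T *m C)).
  by rewrite mulmxDr mulmx1 !mulmxA.
rewrite det_mulmx (det_addC E); congr (_ * _).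
(* The inverse is cleared by inserting the factor [det (1 - T B) = 1]; then
   [(1 - T B) + T C E = 1 + T (C E - B)]. *)
rewrite -[LHS]mul1r -[X in X * _ = _]h.
 rewrite -det_mulmx [in LHS]mulmxDr mulmx1.
rewrite !mulmxA mulmxV // mul1mx mulmxBr -!mulmxA; congr (\det _).
by rewrite addrAC addrA.
Qed.

Lemma det_conj (n : nat) (d : 'I_n -> F) (K K' : 'M[F]_n) :
  (forall i, d i \is a GRing.unit) ->
  (forall i j, K' i j = d i * K i j / d j) -> \det K' = \det K.
Proof.
move=> du hK.
have e : K' *m diag_mx (\row_i d i) = diag_mx (\row_i d i) *m K.
  apply/matrixP => i j; rewrite mul_mx_diag mul_diag_mx !mxE hK.
  by rewrite mulrVK.
have := congr1 determinant e; rewrite !det_mulmx mulrC => /mulrI; apply.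
by rewrite det_diag rpred_prod // => i _; rewrite mxE.
Qed.

(** The unipotent [U] subtracts from each column the next one. This turns the last row of ones into
    a single 1 in the corner, along which the determinant is expanded. *)
Lemma det_differences (n : nat) (H : 'I_n.+1 -> nat -> F) :
  (forall j, H ord_max j = 1) ->
  \det (\matrix_(i < n, j < n) (H (widen_ord (leqnSn n) i) j -
                                H (widen_ord (leqnSn n) i) j.+1)) =
  \det (\matrix_(i < n.+1, j < n.+1) H i j).
Proof.
move=> h1.
pose M := \matrix_(i < n.+1, j < n.+1) H i j.
pose U := \matrix_(i < n.+1, j < n.+1)
  ((i == j)%:R - (i == j.+1 :> nat)%:R : F).
have dU : \det U = 1.
  rewrite det_trig; last first.
    apply/is_trig_mxP => i j lij; rewrite mxE.
    by rewrite -val_eqE /= (ltn_eqF lij) (ltn_eqF (leqW lij)) subr0.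
  by rewrite big1 // => i _; rewrite mxE eqxx (ltn_eqF (ltnSn _)) subr0.
have MU i j : (M *m U) i j =
    H i j - (if (j < n)%N then H i j.+1 else 0).
  rewrite mxE.
  under eq_bigr do rewrite !mxE mulrBr.
  rewrite sumrB; congr (_ - _).
    by rewrite (bigD1 j) //= eqxx mulr1 big1 ?addr0 // => k /negPf->; rewrite mulr0.
  case: ltnP => hj.
    have hj1 : (j.+1 < n.+1)%N by rewrite ltnS.
    rewrite (bigD1 (Ordinal hj1)) //= eqxx mulr1 big1 ?addr0 // => k.
    by rewrite -val_eqE /= => /negPf->; rewrite mulr0.
  rewrite big1 // => k _; rewrite ltn_eqF ?mulr0 //.
  exact: leq_trans (ltn_ord k) _.
rewrite -[RHS]mulr1 -dU -det_mulmx (expand_det_row _ ord_max).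
rewrite (bigD1 ord_max) //= big1 ?addr0 => [|j jm]; last first.
  have hj : (j < n)%N.
    by rewrite ltn_neqAle -ltnS ltn_ord andbT; move: jm; rewrite -val_eqE.
  by rewrite MU hj !h1 subrr mul0r.
rewrite MU /= ltnn h1 subr0 mul1r /cofactor /= -signr_odd oddD addbb expr0 mul1r.
congr (\det _); apply/matrixP => i j.
have lm (k : 'I_n) : lift ord_max k = widen_ord (leqnSn n) k.
  by apply: val_inj; rewrite /= /bump leqNgt ltn_ord.
by rewrite mxE [RHS]mxE [RHS]mxE !lm MU /= ltn_ord.
Qed.

End Determinants.

(** The signs have the same form as in [det_sieve], so that the two expansions can be compared set
    by set. *)
Lemma prodB1_set (F : fieldType) (n : nat) (u : 'I_n -> F) :
  \prod_(i < n) (1 - u i) =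
  \sum_(S : {set 'I_n}) (\prod_(i in S) -1) * \prod_(i in S) u i.
Proof.
under eq_bigr do rewrite addrC.
rewrite bigA_distr; apply: eq_bigr => S _.
rewrite [in RHS](big_mkcond (fun i => i \in S)) /=.
rewrite [X in _ = _ * X](big_mkcond (fun i => i \in S)) /= -big_split.
by apply: eq_bigr => i _ /=; case: (i \in S); rewrite ?mulN1r ?mul1r.
Qed.

(** * Gelfand-Tsetlin schemes *)

Definition irange (b a : int) : seq int :=
  if b <= a then [seq b + k%:Z | k <- iota 0 `|a - b|.+1] else [::].

Lemma mem_irange b a x : (x \in irange b a) = (b <= x <= a).
Proof.
rewrite /irange; case: ifP => hba; last first.
  rewrite in_nil; apply/esym/negbTE/negP => /andP[h1 h2].
  by rewrite (le_trans h1 h2) in hba.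
apply/mapP/idP => [[k]|hx].
  rewrite mem_iota => hk ->; lia.
by exists `|x - b|%N; [rewrite mem_iota; lia | lia].
Qed.

Lemma irange_uniq b a : uniq (irange b a).
Proof.
rewrite /irange; case: ifP => // _; rewrite map_inj_uniq ?iota_uniq //.
by move=> i j /addrI [].
Qed.

Lemma telescope_irange (V : zmodType) (f : int -> V) b a : b <= a ->
  \sum_(x <- irange b a) (f x - f (x - 1)) = f a - f (b - 1).
Proof.
move=> hba; rewrite /irange hba big_map.
rewrite (eq_bigr (fun k : nat => f (b - 1 + k.+1%:Z) - f (b - 1 + k%:Z))).
  have -> : iota 0 `|a - b|.+1 = index_iota 0 `|a - b|.+1.
    by rewrite /index_iota subn0.
  by rewrite telescope_sumr // addr0; congr (f _ - _); lia.
by move=> k _; congr (f _ - f _); lia.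
Qed.

Fixpoint lower_rows (l : seq int) : seq (seq int) :=
  if l is a :: l' then
    if l' is b :: _ then [seq x :: r | x <- irange b a, r <- lower_rows l']
    else [:: [::]]
  else [:: [::]].

Lemma mem_lower_rows (l mu : seq int) :
  reflect (size mu = (size l).-1 /\ interlace mu l) (mu \in lower_rows l).
Proof.
elim: l mu => [|a [|b l] IH] mu.
- rewrite inE; apply: (iffP eqP) => [->|[/size0nil ->]] //; by split=> // j.
- rewrite inE; apply: (iffP eqP) => [->|[/size0nil ->]] //; by split=> // j.
apply: (iffP allpairsP) => [[[x r] /= [hx hr ->]]|[hs hi]].
  move: hr => /IH [hs hi]; split; first by rewrite /= hs.
  by case=> [_|j hj]; [move: hx; rewrite mem_irange | exact: hi].
case: mu hs hi => // x r [hs] hi; exists (x, r) => /=; split=> //.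
  by rewrite mem_irange; exact: (hi 0%N).
by apply/IH; split=> // j hj; exact: (hi j.+1).
Qed.

Lemma lower_rows_uniq l : uniq (lower_rows l).
Proof.
elim: l => [|a [|b l] IH] //=.
by apply: allpairs_uniq => //; [exact: irange_uniq | move=> [? ?] [? ?] _ _ [-> ->]].
Qed.

Lemma interlace_sorted mu l : interlace mu l -> size l = (size mu).+1 -> sorted >=%R mu.
Proof.
move=> hi hs; apply/(sortedP 0) => i hi1.
have /andP[h1 _] := hi i (ltnW hi1); have /andP[_ h2] := hi i.+1 hi1.
exact: le_trans h2 h1.
Qed.

(** Distributivity: the coordinates of an interlacing row vary independently, each in its own
    interval. *)
Lemma sum_lower_rows (F : comPzRingType) (f : nat -> int -> F) l :
  \sum_(mu <- lower_rows l) \prod_(j < (size l).-1) f j mu`_j =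
  \prod_(j < (size l).-1) \sum_(x <- irange l`_j.+1 l`_j) f j x.
Proof.
elim: l f => [|a [|b l] IH] f; try by rewrite big_seq1 !big_ord0.
rewrite [lower_rows _]/= big_allpairs_dep /= [RHS]big_ord_recl /=.
rewrite -[X in _ = _ * X]/(\prod_(j < (size (b :: l)).-1)
  \sum_(x <- irange (b :: l)`_j.+1 (b :: l)`_j) f j.+1 x).
rewrite -(IH (fun j => f j.+1)) big_distrl /=.
apply: eq_bigr => x _; rewrite big_distrr /=; apply: eq_bigr => r _.
by rewrite big_ord_recl.
Qed.

Fixpoint schemes (N : nat) (l : seq int) : seq (N.-tuple (seq int)) :=
  if N is N'.+1 then
    [seq (rcons_tuple s l) | mu <- lower_rows l, s <- schemes N' mu]
  else [:: [tuple]].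

Lemma level_rcons N (s : N.-tuple (seq int)) l m : (0 < m <= N)%N ->
  level (rcons_tuple s l) m = level s m.
Proof.
by case: m => // m /= hm; rewrite /level /= nth_rcons size_tuple hm.
Qed.

Lemma level_rcons_top N (s : N.-tuple (seq int)) l :
  level (rcons_tuple s l) N.+1 = l.
Proof. by rewrite /level /= nth_rcons size_tuple ltnn eqxx. Qed.

Lemma tuple_rconsP (T : Type) N (s : N.+1.-tuple T) :
  exists (s' : N.-tuple T) a, s = (rcons_tuple s' a).
Proof.
case: s => s; case/lastP: s => [|s' a] // hs.
have hs' : size s' == N by move: hs; rewrite size_rcons.
by exists (Tuple hs'), a; apply: val_inj.
Qed.

Lemma rcons_tuple_inj (T : Type) N (s s' : N.-tuple T) a a' :
  (rcons_tuple s a) = (rcons_tuple s' a') -> s = s' /\ a = a'.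
Proof.
move/(congr1 val) => /= /(congr1 rev); rewrite !rev_rcons => -[-> /(congr1 rev)].
by rewrite !revK => /val_inj ->.
Qed.

Lemma mem_schemes N (l : seq int) (s : N.-tuple (seq int)) :
  size l = N -> sorted >=%R l ->
  s \in schemes N l <->
  [/\ forall m, (1 <= m <= N)%N -> signature m (level s m),
      forall m, (2 <= m <= N)%N -> interlace (level s m.-1) (level s m)
    & (0 < N)%N -> level s N = l].
Proof.
elim: N l s => [|N IH] l s hs hl.
  rewrite inE; split=> [_|_]; last by rewrite tuple0.
  by split=> // m /andP[h1 h2]; lia.
have [s' [a ->]] := tuple_rconsP s; split.
  case/allpairsPdep => mu [r [hmu hr er]]; have [? ?] := rcons_tuple_inj er; subst r a.
  have /mem_lower_rows [hsm him] := hmu.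
  rewrite hs /= in hsm.
  have hlm : sorted >=%R mu by apply: (interlace_sorted him); rewrite hs hsm.
  have [h1 h2 h3] := (IH mu s' hsm hlm).1 hr.
  split=> [m hm|m hm|_]; last by rewrite level_rcons_top.
    have [/eqP->|hmN] := boolP (m == N.+1); first by rewrite level_rcons_top; split.
    rewrite level_rcons; last lia.
    by apply: h1; lia.
  have [/eqP e|hmN] := boolP (m == N.+1).
    rewrite e level_rcons_top level_rcons; last lia.
    by rewrite /= h3 //; lia.
  rewrite !level_rcons; try lia.
  by apply: h2; lia.
case=> h1 h2 h3.
have ea : a = l by rewrite -h3 // level_rcons_top.
subst a; apply/allpairsPdep.
have lvl m : (0 < m <= N)%N -> level (rcons_tuple s' l) m = level s' m.
  exact: level_rcons.
have [N0|N0] := posnP N.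
  exists [::], s'; split=> //.
    apply/mem_lower_rows; rewrite hs N0; split=> // j.
  apply/IH => //; split=> //; try lia; by move=> m hm; lia.
have hN : signature N (level s' N) by rewrite -lvl; [apply: h1; lia | lia].
exists (level s' N), s'; split=> //.
  apply/mem_lower_rows; split; first by rewrite hs; exact: hN.1.
  have := h2 N.+1; rewrite level_rcons_top lvl; last lia.
  by apply; lia.
apply/IH; [exact: hN.1 | exact: hN.2 | split=> // m hm].
  by rewrite -lvl; [apply: h1; lia | lia].
by rewrite -!lvl; [apply: h2; lia | lia | lia].
Qed.

(** Distinct rows [mu] give distinct schemes because [mu] is read off as the top row of the shorter
    scheme. Absence of repetitions lets the finitely supported sum over [GT_scheme] become a sum
    over this list. *)
Lemma schemes_uniq N l : size l = N -> sorted >=%R l -> uniq (schemes N l).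
Proof.
elim: N l => [|N IH] l hs hl //.
have hmu mu : mu \in lower_rows l -> size mu = N /\ sorted >=%R mu.
  move/mem_lower_rows => [h1 h2]; rewrite hs in h1; split=> //.
  by apply: (interlace_sorted h2); rewrite hs h1.
apply: allpairs_uniq_dep; first exact: lower_rows_uniq.
  by move=> mu /hmu [h1 h2]; exact: IH.
move=> [mu s] [mu' s'] /allpairsPdep [m1 [r1 [hm1 hr1 [? ?]]]] /allpairsPdep.
case=> [m2 [r2 [hm2 hr2 [? ?]]]]; subst mu mu' s s'.
move=> /= er; have [/= ? _] := rcons_tuple_inj er; subst r2.
have [a1 b1] := hmu _ hm1; have [a2 b2] := hmu _ hm2.
have [_ _ h1] := (mem_schemes r1 a1 b1).1 hr1.
have [_ _ h2] := (mem_schemes r1 a2 b2).1 hr2.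
have [N0|N0] := posnP N; last by rewrite -h1 // h2.
by rewrite N0 in a1 a2; rewrite (size0nil a1) (size0nil a2).
Qed.

Lemma GT_schemeE N (nu : N.-tuple int) : (0 < N)%N -> sorted >=%R nu ->
  GT_scheme nu = [set` schemes N nu]%classic.
Proof.
move=> hN hnu; apply/seteqP; split=> s /=.
  by move=> [h1 h2 h3]; apply/mem_schemes => //; rewrite size_tuple.
by move/mem_schemes => /(_ (size_tuple _) hnu) [h1 h2 h3]; split=> //; exact: h3.
Qed.

(** * Determinantal partition functions of weighted schemes *)

Section PartitionFunction.
Variable F : comUnitRingType.

(* Interlacing lets the coordinates of a row range over independent intervals,
   so summing a determinant over that row telescopes each of its columns. *)
Lemma partition_function (N : nat) (l : seq int) (g : nat -> int -> F)
    (Psi : nat -> nat -> int -> F) :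
  size l = N -> sorted >=%R l ->
  (forall i m y, (i < m < N)%N ->
     Psi i m.+1 y - Psi i m.+1 (y - 1) = g m y * Psi i m y) ->
  (forall i y, (i < N)%N -> Psi i i.+1 y = 1) ->
  \sum_(s <- schemes N l)
    \prod_(m < N) \prod_(j < m) g m ((level s m)`_j - j.+1%:Z) =
  \det (\matrix_(i < N, j < N) Psi i N (l`_j - j.+1%:Z)).
Proof.
elim: N l => [|N IH] l hs hl hPsi hPsi1.
  by rewrite big_seq1 big_ord0 det_mx00.
rewrite [schemes _ _]/= big_allpairs_dep /=.
(* The row of index [N] is the constant 1, so the determinant drops to size [N], with differences
   between consecutive top particles as entries. *)
rewrite -(@det_differences _ _ (fun i j => Psi i N.+1 (l`_j - j.+1%:Z))); last first.
  by move=> j; exact: hPsi1.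
(* The induction hypothesis handles the levels below [mu]; the weight of the particles of [mu]
   itself is absorbed into the columns. *)
transitivity (\sum_(mu <- lower_rows l)
    \det (\matrix_(i < N, j < N)
       (g N (mu`_j - j.+1%:Z) * Psi i N (mu`_j - j.+1%:Z)))).
  apply: eq_big_seq => mu /mem_lower_rows [hsm him].
  rewrite hs /= in hsm.
  have hlm : sorted >=%R mu by apply: (interlace_sorted him); rewrite hs hsm.
  transitivity ((\prod_(j < N) g N (mu`_j - j.+1%:Z)) *
    \sum_(s <- schemes N mu)
      \prod_(m < N) \prod_(j < m) g m ((level s m)`_j - j.+1%:Z)).
    rewrite big_distrr /=; apply: eq_big_seq => s /(mem_schemes _ hsm hlm) [h1 _ h3].
    rewrite big_ord_recr /= mulrC; congr (_ * _).
      apply: eq_bigr => j _.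
      have N0 : (0 < N)%N := leq_ltn_trans (leq0n j) (ltn_ord j).
      by rewrite level_rcons ?N0 ?leqnn // h3.
    apply: eq_bigr => -[[|m] hm] _ /=; first by rewrite !big_ord0.
    by apply: eq_bigr => j _; rewrite level_rcons //; lia.
  rewrite IH //; [|by move=> i m y hm; apply: hPsi; lia|by move=> i y hi; apply: hPsi1; lia].
  rewrite -[\prod_(j < N) _]/(\prod_(j < N) (fun j : 'I_N => g N (mu`_j - j.+1%:Z)) j).
  rewrite mulrC; have -> : \prod_(j < N) g N (mu`_j - j.+1%:Z) =
     \det (diag_mx (\row_(j < N) g N (mu`_j - j.+1%:Z))).
    by rewrite det_diag; apply: eq_bigr => j _; rewrite mxE.
  rewrite -det_mulmx; congr (\det _); apply/matrixP => i j.
  by rewrite mul_mx_diag !mxE mulrC.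
(* In the Leibniz expansion each permutation contributes a product over the coordinates of [mu], to
   which [sum_lower_rows] applies. *)
rewrite /determinant exchange_big /=; apply: eq_bigr => p _.
rewrite -big_distrr /=; congr (_ * _).
(* [sum_lower_rows] wants a family indexed by all naturals; the value 0 outside ['I_N] is never
   reached. *)
pose f (j : nat) (x : int) := if insub j is Some k then
  g N (x - j.+1%:Z) * Psi ((p^-1)%g k : 'I_N) N (x - j.+1%:Z) else 0.
transitivity (\sum_(mu <- lower_rows l) \prod_(j < (size l).-1) f j mu`_j).
  apply: eq_bigr => mu _; rewrite hs /= [LHS](reindex_inj (@perm_inj _ p^-1%g)) /=.
  by apply: eq_bigr => j _; rewrite mxE permKV /f valK.
rewrite sum_lower_rows hs /= [RHS](reindex_inj (@perm_inj _ p^-1%g)) /=.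
apply: eq_bigr => j _; rewrite mxE permKV /=.
have hle : l`_j.+1 <= l`_j.
  by move/(sortedP 0): hl; apply; rewrite hs ltnS.
pose H x := Psi ((p^-1)%g j : 'I_N) N.+1 (x - j.+1%:Z).
transitivity (\sum_(x <- irange l`_j.+1 l`_j) (H x - H (x - 1))).
  apply: eq_bigr => x _; rewrite /f valK /H.
  have -> : x - 1 - j.+1%:Z = x - j.+1%:Z - 1 by lia.
  by rewrite hPsi // ltn_ord ltnSn.
(* The lower end of the telescope, [l_(j+1) - 1] shifted by [j + 1], is the position of the next top
   particle. *)
rewrite telescope_irange // /H; congr (_ - Psi _ _ _); move: (l`_j.+1) => a; lia.
Qed.

End PartitionFunction.

(** * Interpolation and perturbed partition functions *)

Section Lagrange.
Variables (F : fieldType) (N : nat) (a : 'I_N -> F).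

Definition nodal (r : 'I_N) : {poly F} := \prod_(s | s != r) ('X - (a s)%:P).

Hypothesis a_inj : injective a.

Lemma nodal_neq0 r : (nodal r).[a r] != 0.
Proof.
rewrite horner_prod prodf_seq_neq0; apply/allP => s _; apply/implyP => sr.
by rewrite hornerXsubC subr_eq0 (inj_eq a_inj) eq_sym.
Qed.

Lemma nodal_root r s : s != r -> (nodal r).[a s] = 0.
Proof.
by move=> sr; rewrite horner_prod (bigD1 s) //= hornerXsubC subrr mul0r.
Qed.

Lemma size_nodal r : size (nodal r) = N.
Proof.
have -> : nodal r = \prod_(b <- [seq a s | s <- enum (predC1 r)]) ('X - b%:P).
  by rewrite big_map big_enum.
by rewrite size_prod_XsubC size_map -cardE cardC1 card_ord prednK // (leq_ltn_trans _ (ltn_ord r)).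
Qed.

Lemma lagrange_interpolation (p : {poly F}) : (size p <= N)%N ->
  p = \sum_r (p.[a r] / (nodal r).[a r]) *: nodal r.
Proof.
move=> hp; apply/eqP; rewrite -subr_eq0; apply/eqP.
set d := p - _.
have hd : (size d <= N)%N.
  rewrite (leq_trans (size_polyD _ _)) // geq_max hp size_polyN.
  apply: (leq_trans (size_sum _ _ _)); apply/bigmax_leqP => r _.
  by rewrite (leq_trans (size_scale_leq _ _)) // size_nodal.
have rd r : root d (a r).
  rewrite rootE /d hornerD hornerN horner_sum (bigD1 r) //= hornerZ.
  rewrite divfK ?nodal_neq0 // big1 ?addr0 ?subrr // => s sr.
  by rewrite hornerZ (@nodal_root s r) ?mulr0 // eq_sym.
apply: (@roots_geq_poly_eq0 _ d [seq a r | r <- enum 'I_N]).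
- by apply/allP => _ /mapP[r _ ->]; exact: rd.
- by rewrite map_inj_uniq ?enum_uniq.
by rewrite size_map -cardE card_ord.
Qed.

(** Compare the coefficients of [X^i] in the interpolation of [X^k]. In other words, the nodal
    coefficients divided by the nodal values form the inverse Vandermonde matrix. *)
Lemma sum_nodal_coef (k i : nat) : (k < N)%N ->
  \sum_r a r ^+ k * ((nodal r)`_i / (nodal r).[a r]) = (k == i)%:R.
Proof.
move=> hk; have := @lagrange_interpolation 'X^k.
rewrite size_polyXn => /(_ hk) /(congr1 (fun p : {poly F} => p`_i)).
rewrite coefXn eq_sym coef_sum => ->; apply: eq_bigr => r _.
by rewrite coefZ hornerXn mulrAC mulrA.
Qed.

End Lagrange.

(** * q-Pochhammer symbols and solutions of the q-weighted recursion *)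

Section QAlgebra.
Variables (F : fieldType) (q : F).
Hypotheses (q0 : q != 0) (q1 : forall k, (0 < k)%N -> 1 - q ^+ k != 0).

Lemma qpochSr (a p : F) m : qpoch a p m.+1 = qpoch a p m * (1 - a * p ^+ m).
Proof. by rewrite /qpoch big_ord_recr. Qed.

Lemma qpochSl (a p : F) m : qpoch a p m.+1 = (1 - a) * qpoch (a * p) p m.
Proof.
rewrite /qpoch big_ord_recl expr0 mulr1; congr (_ * _).
by apply: eq_bigr => i _; rewrite /= exprS mulrA.
Qed.

Lemma qpoch0 (a p : F) : qpoch a p 0 = 1.
Proof. by rewrite /qpoch big_ord0. Qed.

Lemma qpochqq_neq0 m : qpoch q q m != 0.
Proof.
by rewrite prodf_seq_neq0; apply/allP => i _ /=; rewrite -exprS q1.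
Qed.

Lemma qpochV_neq0 m : qpoch q^-1 q^-1 m != 0.
Proof.
rewrite prodf_seq_neq0; apply/allP => i _ /=; rewrite -exprS exprVn.
have := q1 (ltn0Sn i); apply: contra; rewrite !subr_eq0 => /eqP e.
by rewrite -[q ^+ _]invrK -e invr1.
Qed.

(** [(q^M; q^-1)_m] consists of the last [m] factors of [(q; q)_M]. *)
Lemma qpoch_down M m : (m <= M)%N ->
  qpoch (q ^+ M) q^-1 m * qpoch q q (M - m) = qpoch q q M.
Proof.
elim: m => [|m IH] hm; first by rewrite qpoch0 mul1r subn0.
rewrite -IH ?(ltnW hm) // qpochSr -mulrA; congr (_ * _).
have -> : (M - m)%N = (M - m.+1).+1 by lia.
rewrite qpochSr mulrC -exprS exprVn -expfB; last lia.
by have -> : (M - m)%N = (M - m.+1).+1 by lia.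
Qed.

(** Coefficient of [y^i] in the hypergeometric series. The first factor comes from the parameter
    [a = q^-1], the last from the [(p; p)_i] of the series. *)
Definition phi_coef (N n i : nat) : F :=
  qpoch q^-1 q^-1 i * qpoch (q ^+ (n - 1)) q^-1 i / qpoch (q ^+ (N - 1)) q^-1 i
  / qpoch q^-1 q^-1 i.

(** The prefactor of the kernel turns the coefficient into the ratio of the normalizations of
    [psi i N] and [psi i n]; this is how the hypergeometric series enters. *)
Lemma phi_coefE N n i : (i < n <= N)%N ->
  qpoch (q ^+ (N - 1)) q^-1 (N - n) * phi_coef N n i =
  qpoch q q (N - 1 - i) / qpoch q q (n - 1 - i).
Proof.
move=> hi; rewrite /phi_coef.
have h1 := @qpoch_down (N - 1) (N - n) ltac:(lia).
have h2 := @qpoch_down (n - 1) i ltac:(lia).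
have h3 := @qpoch_down (N - 1) i ltac:(lia).
rewrite (_ : N - 1 - (N - n) = n - 1)%N in h1; last lia.
have v0 := qpochV_neq0 i.
have z1 := qpochqq_neq0 (N - 1); have z2 := qpochqq_neq0 (n - 1).
have z3 := qpochqq_neq0 (n - 1 - i); have z4 := qpochqq_neq0 (N - 1 - i).
have u3 : qpoch (q ^+ (N - 1)) q^-1 i != 0.
  by move: z1; rewrite -h3 mulf_eq0 negb_or => /andP[].
move: h1 h2 h3 v0 z1 z2 z3 z4 u3.
move: (qpoch q q (N - 1)) (qpoch q q (n - 1)) => X Y.
move: (qpoch q q (n - 1 - i)) (qpoch q q (N - 1 - i)) => Z W.
move: (qpoch (q ^+ _) _ _) (qpoch (q ^+ _) _ _) (qpoch (q ^+ _) _ _) => A B C.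
move: (qpoch _ _ _) => V.
move=> h1 h2 h3 v0 _ _ z3 _ u3.
have -> : C * (V * B / A / V) = C * (B * Z) / (A * Z) by field; apply/and3P.
by rewrite h2 h1 -h3; field; apply/andP.
Qed.

(** The unperturbed solution that starts as the constant 1 at level [i + 1]. *)
Definition psi (i m : nat) (y : int) : F :=
  if (i < m)%N then q ^ (- ((m - 1 - i)%:Z * y)) / qpoch q q (m - 1 - i) else 0.

(** Green's function of the recursion: the solution created by a unit source at [(x, n)], zero to
    the left of [x] and at levels up to [n]. *)
Definition response (x : int) (n m : nat) (y : int) : F :=
  if (n < m)%N && (x <= y) then
    q ^ (- x) * q ^ (- ((m - 1 - n)%:Z * y)) *
    (qpoch (q ^ (y - x + 1)) q (m - n - 1) / qpoch q q (m - n - 1))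
  else 0.

Lemma psi_diag i y : psi i i.+1 y = 1.
Proof.
rewrite /psi ltnSn (_ : i.+1 - 1 - i = 0)%N; last lia.
by rewrite qpoch0 mul0r oppr0 expr0z divr1.
Qed.

Lemma psi_diff i m y : psi i m.+1 y - psi i m.+1 (y - 1) = q ^ (- y) * psi i m y.
Proof.
have [him|] := ltnP i m; last first.
  rewrite leq_eqVlt => /orP[/eqP->|h]; first by rewrite !psi_diag subrr /psi ltnn mulr0.
  rewrite /psi !ifF ?subrr ?mulr0 //; lia.
rewrite /psi ltnS (ltnW him) him.
rewrite (_ : m.+1 - 1 - i = (m - 1 - i).+1)%N; last lia.
set j := (m - 1 - i)%N; rewrite qpochSr.
have -> : q ^ (- (j.+1%:Z * y)) = q ^ (- y) * q ^ (- (j%:Z * y)).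
  by rewrite -expfzDr //; congr (q ^ _); lia.
have -> : q ^ (- (j.+1%:Z * (y - 1))) = q ^ (- y) * q ^ (- (j%:Z * y)) * (q * q ^+ j).
  by rewrite -exprS exprnP -!expfzDr //; congr (q ^ _); lia.
have := qpochqq_neq0 j; have := q1 (ltn0Sn j); rewrite exprS.
move: (q ^+ j) (qpoch _ _ _) (q ^ _) (q ^ _) => J P A B h1 h2.
by field; apply/andP.
Qed.

Lemma response_diff x n m y :
  response x n m.+1 y - response x n m.+1 (y - 1) =
  q ^ (- y) * (response x n m y + ((m == n) && (y == x))%:R).
Proof.
have [hnm|] := ltnP n m; last first.
  rewrite leq_eqVlt => /orP[/eqP->|h]; last first.
    have e1 : (n < m.+1)%N = false by lia.
    have e2 : (n < m)%N = false by lia.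
    have e3 : (m == n) = false by lia.
    by rewrite /response e1 e2 e3 /= addr0 subrr mulr0.
  rewrite /response eqxx ltnSn ltnn /= add0r (_ : n.+1 - 1 - n = 0)%N; last lia.
  rewrite (_ : n.+1 - n - 1 = 0)%N; last lia.
  rewrite !qpoch0 !mul0r !oppr0 !expr0z divr1 !mulr1.
  have [->|yx] := eqVneq y x.
    rewrite lexx ifF ?subr0 ?mulr1 //; lia.
  rewrite mulr0; case: ifP => h; case: ifP => h'; rewrite ?subrr //; lia.
rewrite (_ : (m == n) = false) ?addr0; last lia.
have [hxy|hxy] := lerP x y; last first.
  have e1 : (x <= y) = false by lia.
  have e2 : (x <= y - 1) = false by lia.
  by rewrite /response e1 e2 !andbF subrr mulr0.
rewrite /response hnm hxy ltnS (ltnW hnm) /=.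
rewrite (_ : m.+1 - 1 - n = (m - 1 - n).+1)%N; last lia.
rewrite (_ : m.+1 - n - 1 = (m - 1 - n).+1)%N; last lia.
rewrite (_ : m - n - 1 = m - 1 - n)%N; last lia.
set j := (m - 1 - n)%N; rewrite qpochSr [qpoch q q _]qpochSr.
(* One closed form covers [y = x] as well: there the factor [1 - q^(y - x)] of the Pochhammer symbol
   vanishes. *)
have -> : (if x <= y - 1 then
     q ^ (- x) * q ^ (- (j.+1%:Z * (y - 1))) *
     (qpoch (q ^ (y - 1 - x + 1)) q j.+1 / (qpoch q q j * (1 - q * q ^+ j)))
   else 0) =
  q ^ (- x) * (q ^ (- y) * q ^ (- (j%:Z * y)) * (q * q ^+ j)) *
  ((1 - q ^ (y - x)) * qpoch (q ^ (y - x + 1)) q j /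
    (qpoch q q j * (1 - q * q ^+ j))).
  case: ifP => h; last first.
    rewrite (_ : y - x = 0); last lia.
    by rewrite expr0z subrr !mul0r mulr0.
  rewrite (_ : y - 1 - x + 1 = y - x); last lia.
  rewrite qpochSl (_ : q ^ (y - x) * q = q ^ (y - x + 1)); last first.
    by rewrite [RHS]expfzDr ?q0.
  congr (_ * _ * _).
  by rewrite -exprS exprnP -!expfzDr //; congr (q ^ _); lia.
have -> : q ^ (- (j.+1%:Z * y)) = q ^ (- y) * q ^ (- (j%:Z * y)).
  by rewrite -expfzDr //; congr (q ^ _); lia.
have -> : q ^ (y - x + 1) = q ^ (y - x) * q by rewrite [LHS]expfzDr ?q0.
have := qpochqq_neq0 j; have := q1 (ltn0Sn j); rewrite exprS.
move: (q ^+ j) (qpoch _ _ j) (qpoch q q _) (q ^ (- x)) (q ^ (- y)).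
move: (q ^ (- (j%:Z * y))) (q ^ (y - x)) => D E J P U A B h1 h2.
by field; apply/andP.
Qed.

Lemma exprz_inj : injective (fun k : int => q ^ k).
Proof.
have pos (k : int) (m : nat) : q ^ k = q ^ (k + m%:Z) -> m = 0%N.
  rewrite expfzDr // -{1}[q ^ k]mulr1 => /(mulfI (expfz_neq0 _ q0)) e.
  case: m e => // m e; have := q1 (ltn0Sn m).
  by rewrite exprnP -e subrr eqxx.
move=> k k' /= e; have [h|h] := lerP k k'.
  have := pos k `|k' - k|%N; rewrite (_ : k + _ = k'); last lia.
  by move=> /(_ e); lia.
have := pos k' `|k - k'|%N; rewrite (_ : k' + _ = k); last lia.
by move=> /(_ (esym e)); lia.
Qed.

(** * Changing the weight at finitely many points *)

Section Points.
Variables (N : nat) (l : seq int) (s : nat) (x : 'I_s -> int) (n : 'I_s -> nat).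
Hypotheses (hsz : size l = N) (hl : sorted >=%R l).
Hypothesis hn : forall k, (1 <= n k <= N - 1)%N.

Let top (r : nat) : int := l`_r - r.+1%:Z.

Definition top_psi : 'M[F]_N := \matrix_(i, r) psi i N (top r).
Definition point_psi : 'M[F]_(N, s) := \matrix_(i, k) psi i (n k) (x k).
Definition point_response : 'M[F]_s := \matrix_(k, k') response (x k) (n k) (n k') (x k').
Definition top_response : 'M[F]_(s, N) := \matrix_(k, r) response (x k) (n k) N (top r).

(** A source acts only on strictly higher levels, so the matrix is strictly triangular for the
    grading by level. *)
Lemma det_point_response (t : 'rV[F]_s) :
  \det (1%:M - diag_mx t *m point_response) = 1.
Proof.
apply: (det_strict (f := n)) => i j hij.
by rewrite mul_diag_mx !mxE /response (negPf hij) mulr0.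
Qed.

Section Perturbed.
Variable t : 'rV[F]_s.

Let T := diag_mx t.
(** Solution of [At = point_psi + At T point_response], the self-consistency equation for the values
    at the points of the perturbed solutions [Psi]. *)
Let At : 'M[F]_(N, s) := point_psi *m invmx (1%:M - T *m point_response).

Let at_ (i : nat) (k : 'I_s) : F := if insub i is Some i' then At i' k else 0.

(** Extra weight [t_k] at a point acts as a source of strength [t_k] times the value of the solution
    there; [Psi] adds the responses to all these sources. *)
Let Psi (i m : nat) (y : int) : F :=
  psi i m y + \sum_k at_ i k * t 0 k * response (x k) (n k) m y.

Lemma at_eq i k : (i < N)%N -> at_ i k = Psi i (n k) (x k).
Proof.
move=> hi; have e : At = point_psi + At *m T *m point_response.
  have u : 1%:M - T *m point_response \in unitmx.
    by rewrite unitmxE det_point_response unitr1.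
  apply/eqP; rewrite -subr_eq; apply/eqP.
  by rewrite -mulmxA -{1}[At]mulmx1 -mulmxBr mulmxKV.
rewrite /Psi /at_ insubT /= {1}e mxE mxE; congr (_ + _).
by rewrite mxE; apply: eq_bigr => k' _; rewrite mul_mx_diag !mxE.
Qed.

(** By strong induction on the level: [psi i] vanishes up to level [i], and a point is influenced
    only by points of lower level. Hence the perturbation leaves the initial value 1 at level
    [i + 1] intact. *)
Lemma at_eq0 i k : (n k <= i < N)%N -> at_ i k = 0.
Proof.
elim: (n k).+1 {-2}k (ltnSn (n k)) => // b IH {}k hb /andP[hk hi].
rewrite at_eq // /Psi /psi ltnNge hk add0r big1 // => k' _.
rewrite /response; case: ifP => [/andP[hkk _]|]; last by rewrite mulr0.
by rewrite IH ?mul0r //; lia.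
Qed.

Lemma sum_schemes_perturbed :
  \sum_(a <- schemes N l) \prod_(m < N) \prod_(j < m)
    (let y := (level a m)`_j - j.+1%:Z in
     q ^ (- y) * (1 + \sum_k t 0 k * ((m == n k :> nat) && (y == x k))%:R)) =
  \det (top_psi + point_psi *m invmx (1%:M - diag_mx t *m point_response)
    *m diag_mx t *m top_response).
Proof.
pose g (m : nat) (y : int) :=
  q ^ (- y) * (1 + \sum_k t 0 k * ((m == n k) && (y == x k))%:R).
rewrite (@partition_function _ _ _ g Psi) //.
- congr (\det _); apply/matrixP => i r; rewrite !mxE /Psi -/(top r).
  congr (_ + _); apply: eq_bigr => k _.
  by rewrite mul_mx_diag [X in _ = X * _]mxE [top_response _ _]mxE /at_ valK.
- move=> i m y hm0; have hiN : (i < N)%N by lia.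
  (* The source terms carry [at_ i k], which equals [Psi] at the point by [at_eq]; they supply the
     factor [1 + t_k] of the weight [g]. *)
  rewrite /Psi opprD addrACA psi_diff -sumrB.
  under eq_bigr do rewrite -mulrBr response_diff mulrCA.
  rewrite -mulr_sumr -mulrDr /g -mulrA; congr (_ * _).
  under eq_bigr do rewrite mulrDr.
  rewrite big_split /= addrA [RHS]mulrDl mul1r; congr (_ + _).
  rewrite mulr_suml; apply: eq_bigr => k _.
  have [/andP[/eqP-> /eqP->]|_] := boolP ((m == n k) && (y == x k)).
    by rewrite /= !mulr1 at_eq // mulrC.
  by rewrite !mulr0 mul0r.
move=> i y hi; rewrite /Psi psi_diag big1 ?addr0 // => k _.
rewrite /response; case: ifP => [/andP[hk _]|]; last by rewrite mulr0.
by rewrite at_eq0 ?mul0r //; lia.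
Qed.

End Perturbed.

(** The zeros in [w] and possible poles in [z] of the product in the integrand. *)
Definition node (x1 : int) (r : 'I_N) : F := q ^ (top r - x1).

(* Column [k] represents the linear functional [psi i N |-> psi i (n k) (x k)] as a
   combination of evaluations at the top particles. *)
Definition source : 'M[F]_(N, s) := \matrix_(r, k)
  (q ^ ((N - n k)%:Z * x k) * node (x k) r ^+ (N - 1) *
   ((\sum_(i < n k) qpoch (q ^+ (N - 1)) q^-1 (N - n k) * phi_coef N (n k) i *
      (nodal (node (x k)) r)`_i) / (nodal (node (x k)) r).[node (x k) r])).

Lemma top_inj : injective (fun r : 'I_N => top r).
Proof.
have lt (r r' : 'I_N) : (r < r')%N -> top r' < top r.
  move=> h; rewrite /top.
  have : l`_r' <= l`_r.
    have := sorted_leq_nth (@ge_trans _ int) (@ge_refl _ int) 0 hl.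
    by apply; rewrite ?inE ?hsz // ltnW.
  by move: (l`_r') (l`_r) => a b; lia.
move=> r r' e; apply/val_inj/eqP; rewrite eqn_leq.
by apply/andP; split; rewrite leqNgt; apply/negP => /lt; rewrite e ltxx.
Qed.

Lemma node_inj x1 : injective (node x1).
Proof. by move=> r r' /exprz_inj /addIr /top_inj. Qed.

(** For every base point [x1], [top_psi] is the Vandermonde matrix of the nodes up to scaling of
    rows and columns. *)
Lemma top_psiE (x1 : int) (i r : 'I_N) :
  top_psi i r = q ^ (- ((N - 1 - i)%:Z * x1)) / qpoch q q (N - 1 - i) *
    (node x1 r ^+ i / node x1 r ^+ (N - 1)).
Proof.
rewrite mxE /psi ltn_ord mulrAC; congr (_ * _).
rewrite /node !exprnP !exprz_exp invr_expz -!expfzDr //; congr (q ^ _).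
have -> : (N - 1)%N = ((N - 1 - i) + i)%N by have := ltn_ord i; lia.
by rewrite addnK PoszD; ring.
Qed.

(** The factor [node ^ (N - 1)] undoes the column scaling of [top_psiE], after which the inverse
    Vandermonde matrix selects [f i]. *)
Lemma sum_node (x1 : int) (i : 'I_N) (f : nat -> F) m : (m <= N)%N ->
  \sum_r top_psi i r * (node x1 r ^+ (N - 1) *
    ((\sum_(j < m) f j * (nodal (node x1) r)`_j) / (nodal (node x1) r).[node x1 r])) =
  q ^ (- ((N - 1 - i)%:Z * x1)) / qpoch q q (N - 1 - i) *
    (if (i < m)%N then f i else 0).
Proof.
move=> hm; transitivity (q ^ (- ((N - 1 - i)%:Z * x1)) / qpoch q q (N - 1 - i) *
  \sum_(j < m) f j * \sum_r node x1 r ^+ i *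
     ((nodal (node x1) r)`_j / (nodal (node x1) r).[node x1 r])).
  rewrite !mulr_sumr.
  under [RHS]eq_bigr do rewrite !mulr_sumr.
  rewrite exchange_big; apply: eq_bigr => r _ /=.
  have nz : node x1 r ^+ (N - 1) != 0 by rewrite expf_neq0 // expfz_neq0.
  rewrite (top_psiE x1) [(_ / _) as X in _ * (_ * X)]mulrC.
  rewrite [LHS](_ : _ = q ^ (- ((N - 1 - i)%:Z * x1)) / qpoch q q (N - 1 - i) *
    node x1 r ^+ i * (nodal (node x1) r).[node x1 r]^-1 *
    \sum_(j < m) f j * (nodal (node x1) r)`_j); last first.
    have := nodal_neq0 (@node_inj x1) r.
    have := qpochqq_neq0 (N - 1 - i).
    move: nz; move: (node x1 r ^+ (N - 1)) (node x1 r ^+ i) (q ^ _) => u v w.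
    move: (\sum_(_ < _) _) (_.[_]) (qpoch _ _ _) => a b c h1 h2 h3.
    by field; apply/and3P.
  rewrite mulr_sumr; apply: eq_bigr => j _.
  move: (_ / qpoch _ _ _) (_.[_]^-1) => a b; ring.
congr (_ * _).
under eq_bigr => j _ do rewrite (sum_nodal_coef (@node_inj x1)) ?ltn_ord //.
case: ltnP => him.
  rewrite (bigD1 (Ordinal him)) //= eqxx mulr1 big1 ?addr0 // => j.
  by rewrite -val_eqE /= eq_sym => /negPf->; rewrite mulr0.
by rewrite big1 // => j _; rewrite gtn_eqF ?mulr0 // (leq_trans (ltn_ord j)).
Qed.

Lemma top_psi_source : top_psi *m source = point_psi.
Proof.
apply/matrixP => i k; rewrite mxE.
have hk := hn k.
pose f j := qpoch (q ^+ (N - 1)) q^-1 (N - n k) * phi_coef N (n k) j.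
transitivity (q ^ ((N - n k)%:Z * x k) *
  \sum_r top_psi i r * (node (x k) r ^+ (N - 1) *
    ((\sum_(j < n k) f j * (nodal (node (x k)) r)`_j) /
     (nodal (node (x k)) r).[node (x k) r]))).
  rewrite mulr_sumr; apply: eq_bigr => r _.
  by rewrite [source _ _]mxE /f -mulrA mulrCA.
rewrite sum_node; last lia.
rewrite mxE /psi; case: ltnP => hi; last by rewrite !mulr0.
rewrite /f phi_coefE; last by rewrite hi; lia.
(* [phi_coefE] has exchanged the normalizations of levels [N] and [n k]; the factor
   [q^((N - n k) x_k)] in [source] does the same for the powers. *)
have -> : q ^ (- ((n k - 1 - i)%:Z * x k)) =
    q ^ ((N - n k)%:Z * x k) * q ^ (- ((N - 1 - i)%:Z * x k)).
  rewrite -expfzDr //; congr (q ^ _).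
  have -> : (N - 1 - i = (N - n k) + (n k - 1 - i))%N by lia.
  by rewrite PoszD; ring.
have := qpochqq_neq0 (N - 1 - i); have := qpochqq_neq0 (n k - 1 - i).
move: (q ^ _) (q ^ _) (qpoch _ _ _) (qpoch _ _ _) => a b c d c0 d0.
by field; apply/andP.
Qed.

Lemma det_top_psi_neq0 : \det top_psi != 0.
Proof.
(* An explicit right inverse: the inverse Vandermonde matrix at base point 0, with the scalings of
   [top_psiE] undone. *)
pose M : 'M[F]_N := \matrix_(r, j) (node 0 r ^+ (N - 1) *
   ((nodal (node 0) r)`_j / (nodal (node 0) r).[node 0 r]) * qpoch q q (N - 1 - j)).
suff e : top_psi *m M = 1%:M.
  have := congr1 determinant e; rewrite det_mulmx det1 => e'.
  by apply/negP => /eqP z; move/eqP: e'; rewrite z mul0r eq_sym oner_eq0.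
apply/matrixP => i j; rewrite !mxE.
under eq_bigr do rewrite (top_psiE 0) mxE mulr0 oppr0 expr0z.
transitivity ((1 / qpoch q q (N - 1 - i)) * qpoch q q (N - 1 - j) *
  \sum_r node 0 r ^+ i * ((nodal (node 0) r)`_j / (nodal (node 0) r).[node 0 r])).
  rewrite mulr_sumr; apply: eq_bigr => r _.
  have nz : node 0 r ^+ (N - 1) != 0 by rewrite expf_neq0 // expfz_neq0.
  have := qpochqq_neq0 (N - 1 - i); have := nodal_neq0 (@node_inj 0) r => h1 h2.
  by field; apply/and3P.
rewrite sum_nodal_coef //; last exact: node_inj.
have [->|ij] := eqVneq i j; first by rewrite eqxx mulr1 mul1r mulVf ?qpochqq_neq0.
by rewrite (negPf ij : (i == j :> nat) = false) mulr0.
Qed.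

Definition particle_weight (a : N.-tuple (seq int)) : F :=
  \prod_(m < N) \prod_(j < m) q ^ (- ((level a m)`_j - j.+1%:Z)).

(** Since [point_psi] factors through [top_psi], [det_perturb] splits off the unperturbed partition
    function. *)
Lemma sum_schemes_det (t : 'rV[F]_s) :
  \sum_(a <- schemes N l) \prod_(m < N) \prod_(j < m)
    (let y := (level a m)`_j - j.+1%:Z in
     q ^ (- y) * (1 + \sum_k t 0 k * ((m == n k :> nat) && (y == x k))%:R)) =
  \det top_psi *
  \det (1%:M + diag_mx t *m (top_response *m source - point_response)).
Proof.
rewrite sum_schemes_perturbed -top_psi_source.
exact/det_perturb/det_point_response.
Qed.

Lemma partition_weight : \sum_(a <- schemes N l) particle_weight a = \det top_psi.
Proof.
have := sum_schemes_det 0.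
have -> : diag_mx (0 : 'rV[F]_s) = 0.
  by apply/matrixP => i j; rewrite !mxE mul0rn.
rewrite mul0mx addr0 det1 mulr1 => <-.
apply: eq_bigr => a _; apply: eq_bigr => m _; apply: eq_bigr => j _ /=.
by rewrite big1 ?addr0 ?mulr1 // => k _; rewrite mxE mul0r.
Qed.

Hypothesis inj : injective (fun k => (x k, n k)).

Lemma sum_schemes_occupied :
  \sum_(a <- schemes N l | `[< forall k, occupied a (x k) (n k) >]) particle_weight a =
  \det top_psi * \det (top_response *m source - point_response).
Proof.
(* [vac a k] is 1 when no particle sits at point [k] and 0 otherwise. Expanding the product of the
   [1 - vac a k] over sets [S] gives the weights perturbed by [t_k = -1] on [S]. *)
pose vac (a : N.-tuple (seq int)) (k : 'I_s) : F := \prod_(m < N) \prod_(j < m)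
  (1 - ((m == n k :> nat) && ((level a m)`_j - j.+1%:Z == x k))%:R).
have vacE a k : 1 - vac a k = `[< occupied a (x k) (n k) >]%:R.
  have nkN : (n k < N)%N by have := hn k; lia.
  have -> : vac a k = \prod_(j < n k) (1 - ((level a (n k))`_j - j.+1%:Z == x k)%:R).
    rewrite /vac (bigD1 (Ordinal nkN)) //= [X in _ * X]big1 ?mulr1 => [|m].
      by apply: eq_bigr => j _; rewrite eqxx.
    rewrite -val_eqE /= => /negPf mk; apply: big1 => j _.
    by rewrite mk subr0.
  case: asboolP => [[j hj e]|no].
    by rewrite (bigD1 (Ordinal hj)) //= -e eqxx subrr mul0r subr0.
  rewrite big1 ?subrr // => j _; case: eqP => [e|_]; last by rewrite subr0.
  by case: no; exists j.
transitivity (\sum_(a <- schemes N l) particle_weight a * \prod_k (1 - vac a k)).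
  rewrite big_mkcond /=; apply: eq_bigr => a _.
  case: asboolP => h.
    rewrite big1 ?mulr1 // => k _; rewrite vacE.
    by case: asboolP => // hk; case: hk.
  have [k hk] : exists k, ~ occupied a (x k) (n k) by exact/existsNP.
  rewrite (bigD1 k) //= vacE; case: asboolP => //.
  by rewrite mul0r mulr0.
under eq_bigr do rewrite prodB1_set mulr_sumr.
rewrite exchange_big /= (det_sieve (_ - _)) mulr_sumr; apply: eq_bigr => S _.
rewrite mulrCA -sum_schemes_det mulr_sumr; apply: eq_bigr => a _.
rewrite mulrCA; congr (_ * _).
rewrite /vac [X in _ * X]exchange_big /= -big_split /=; apply: eq_bigr => m _.
rewrite exchange_big /= -big_split /=; apply: eq_bigr => j _.
congr (_ * _); set y := _ - _.
(* By injectivity a particle sits at no more than one point of [S], so the sum in the perturbed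
   weight and the product of vacancy factors agree: both give 0 at a point of [S] and 1
   elsewhere. *)
have [/existsP[k /andP[kS /andP[/eqP mk /eqP yk]]]|] :=
    boolP [exists k in S, (m == n k :> nat) && (y == x k)].
  rewrite (bigD1 k) //= mk yk !eqxx subrr mul0r.
  rewrite (bigD1 k) //= mxE kS !eqxx mulr1 big1 ?addr0 ?addrN // => k' k'k.
  case: andP => [[/eqP nk /eqP xk]|_]; last by rewrite mulr0.
  by case/eqP: k'k; apply: inj; rewrite /= nk xk.
rewrite negb_exists => /forallP no.
rewrite big1 => [|k kS]; last first.
  by have := no k; rewrite kS /= => /negPf->; rewrite subr0.
rewrite big1 ?addr0 // => k _; rewrite mxE.
case: ifP => kS; last by rewrite mul0r.
by have := no k; rewrite kS /= => /negPf->; rewrite mulr0.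
Qed.

(** The kernel with its double integral evaluated: the inverse nodal value is the residue of the
    inverse product at a node, and the sum over [i] is what the integral in [w] leaves there. *)
Definition residue_kernel (x1 : int) (n1 : nat) (x2 : int) (n2 : nat) : F :=
  - (if (n2 < n1)%N && (x2 <= x1)
     then q ^ (n2%:Z * (x1 - x2))
          * (qpoch (q ^ (x1 - x2 + 1)) q (n1 - n2 - 1) / qpoch q q (n1 - n2 - 1))
     else 0)
  + qpoch (q ^+ (N - 1)) q^-1 (N - n1) *
    \sum_(r < N | x2 <= top r)
      q ^ (n2%:Z * (x1 - x2)) * node x1 r ^+ n2
      * (\sum_(i < n1) phi_coef N n1 i * (nodal (node x1) r)`_i)
      * (qpoch (node x1 r * q ^ (1 - x2 + x1)) q (N - n2 - 1)
         / qpoch q q (N - n2 - 1))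
      / (nodal (node x1) r).[node x1 r].

(** The arguments come in the order opposite to the matrix indices: the source column belongs to the
    first particle, the response row to the second. *)
Lemma residue_kernelE k k' :
  residue_kernel (x k') (n k') (x k) (n k) =
  q ^ ((n k' - 1)%:Z * x k') * (top_response *m source - point_response) k k'
  / q ^ ((n k - 1)%:Z * x k).
Proof.
have hk := hn k; have hk' := hn k'.
have e1 : (n k' - 1)%:Z = (n k')%:Z - 1 by lia.
have e2 : (n k - 1)%:Z = (n k)%:Z - 1 by lia.
rewrite /residue_kernel [in RHS]mxE [X in _ = _ * X / _]addrC [in RHS]mulrDr [in RHS]mulrDl.
congr (_ + _).
  rewrite !mxE mulrN mulNr /response; congr (- _).
  case: ifP => [/andP[h1 h2]|]; last by rewrite mulr0 mul0r.
  rewrite [RHS]mulrAC [RHS]mulrA; congr (_ * _).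
  rewrite invr_expz -!expfzDr //; congr (q ^ _).
  have -> : (n k' - 1 - n k)%:Z = (n k')%:Z - 1 - (n k)%:Z by lia.
  by rewrite e1 e2; ring.
rewrite mxE !mulr_sumr mulr_suml [LHS]big_mkcond; apply: eq_bigr => r _ /=.
rewrite !mxE /response (_ : (n k < N)%N = true) /=; last lia.
case: ifP => hr; last by rewrite !mul0r mulr0 mul0r.
have -> : node (x k') r * q ^ (1 - x k + x k') = q ^ (top r - x k + 1).
  by rewrite /node -expfzDr //; congr (q ^ _); ring.
(* All powers of [q] are balanced here; this is where the conjugating factors [q^((n - 1) x)] come
   from. *)
have -> : q ^ ((n k)%:Z * (x k' - x k)) * node (x k') r ^+ n k =
    q ^ ((n k' - 1)%:Z * x k') * (q ^ (- x k) * q ^ (- ((N - 1 - n k)%:Z * top r))) *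
    (q ^ ((N - n k')%:Z * x k') * node (x k') r ^+ (N - 1)) / q ^ ((n k - 1)%:Z * x k).
  rewrite /node !exprnP !exprz_exp invr_expz -!expfzDr //; congr (q ^ _).
  have -> : (N - 1 - n k)%:Z = N%:Z - 1 - (n k)%:Z by lia.
  have -> : (N - n k')%:Z = N%:Z - (n k')%:Z by lia.
  have -> : (N - 1)%:Z = N%:Z - 1 by lia.
  by rewrite e1 e2; ring.
under [in RHS]eq_bigr do rewrite -mulrA.
rewrite -mulr_sumr.
have := qpochqq_neq0 (N - n k - 1) => h1.
have h2 := nodal_neq0 (@node_inj (x k')) r.
have h3 : q ^ ((n k - 1)%:Z * x k) != 0 by rewrite expfz_neq0.
by field; apply/and3P.
Qed.

End Points.
End QAlgebra.

(** * Contour integrals *)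

Import numFieldNormedType.Exports.
Local Open Scope classical_set_scope.
Local Open Scope ring_scope.

(** * Lebesgue integrals over intervals *)

Section IntervalIntegrals.
Variable R : realType.
Notation mu := (@lebesgue_measure R).
Implicit Types (f g : R -> R) (a b c : R).

(** The end points form a null set. This disposes of the uncontrolled values of [path_deriv] at
    break points. *)
Lemma integrable_oo_cc a b f g : {in `]a, b[, f =1 g} ->
  mu.-integrable `[a, b] (EFin \o g) -> mu.-integrable `[a, b] (EFin \o f).
Proof.
move=> fg gi.
have gi' : mu.-integrable `]a, b[ (EFin \o g).
  by apply: integrableS gi => //; exact: subset_itv_oo_cc.
have fi' : mu.-integrable `]a, b[ (EFin \o f).
  apply: eq_integrable gi' => // x; rewrite inE /= => xab.
  by rewrite /= fg.
have /integrableP[mf fo] := fi'.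
apply/integrableP; split.
  by apply/emeasurable_fun_itv_bndo_bndcP/emeasurable_fun_itv_obnd_cbndP.
rewrite integral_itv_bndoo //.
exact: measurableT_comp.
Qed.

Lemma Rintegral_oo_cc a b f g : {in `]a, b[, f =1 g} ->
  mu.-integrable `[a, b] (EFin \o g) ->
  \int[mu]_(x in `[a, b]) f x = \int[mu]_(x in `[a, b]) g x.
Proof.
move=> fg gi; have fi := integrable_oo_cc fg gi.
have sub k : mu.-integrable `[a, b] (EFin \o k) -> measurable_fun `]a, b[ (EFin \o k).
  move=> /integrableP[mk _]; apply: measurable_funS mk => //.
  exact: subset_itv_oo_cc.
rewrite /Rintegral; congr fine.
rewrite integral_itv_bndoo; last exact: sub fi.
rewrite [RHS]integral_itv_bndoo; last exact: sub gi.
by apply: eq_integral => x; rewrite inE /= => xab; rewrite fg.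
Qed.

Lemma integrable_itv_cat a b c f : a <= b -> b <= c ->
  mu.-integrable `[a, b] (EFin \o f) -> mu.-integrable `[b, c] (EFin \o f) ->
  mu.-integrable `[a, c] (EFin \o f).
Proof.
move=> ab bc fab fbc.
have fbc' : mu.-integrable `]b, c] (EFin \o f).
  by apply: integrableS fbc => //; apply: subset_itv; rewrite bnd_simp.
have e : `[a, c]%classic = `[a, b]%classic `|` `]b, c]%classic.
  by rewrite -itv_bndbnd_setU ?bnd_simp.
apply/integrable_mkcond => //.
move/integrable_mkcond : fab => /(_ (measurable_itv _)) h1.
move/integrable_mkcond : fbc' => /(_ (measurable_itv _)) h2.
apply: eq_integrable (integrableD _ h1 h2) => //= x _.
rewrite /patch e in_setU.
have [h3|h3] := boolP (x \in `[a, b]%classic); have [h4|h4] := boolP (x \in `]b, c]%classic).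
- exfalso; move: h3 h4; rewrite !inE /= !in_itv /= => /andP[_ xb] /andP[bx _].
  by rewrite ltNge xb in bx.
- by rewrite adde0.
- by rewrite add0e.
by rewrite adde0.
Qed.

Lemma Rintegral_itv_cat a b c f : a <= b -> b <= c ->
  mu.-integrable `[a, c] (EFin \o f) ->
  \int[mu]_(x in `[a, c]) f x =
  \int[mu]_(x in `[a, b]) f x + \int[mu]_(x in `[b, c]) f x.
Proof.
move=> ab bc fi.
have := @Rintegral_itvB _ f (BLeft a) (BRight c) b fi.
rewrite !bnd_simp => /(_ ab bc) e.
rewrite -(@Rintegral_itv_obnd_cbnd _ b (BRight c)); last first.
  by apply: integrableS fi => //; apply: subset_itv; rewrite bnd_simp.
by rewrite -e addrC subrK.
Qed.

Lemma continuous_itv_integrable a b f :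
  (forall x, a <= x <= b -> {for x, continuous f}) ->
  mu.-integrable `[a, b] (EFin \o f).
Proof.
move=> cf; apply: continuous_compact_integrable; first exact: segment_compact.
apply: continuous_in_subspaceT => x; rewrite inE /= in_itv /=.
exact: cf.
Qed.

Lemma Rintegral_FTC a b f F : a < b ->
  (forall x, a <= x <= b -> {for x, continuous f}) ->
  (forall x, a <= x <= b -> is_derive x 1 F (f x)) ->
  \int[mu]_(x in `[a, b]) f x = F b - F a.
Proof.
move=> ab cf dF.
have cF x : a <= x <= b -> {for x, continuous F}.
  by move=> /dF [dFx _]; apply: differentiable_continuous; exact/derivable1_diffP.
rewrite /Rintegral (@continuous_FTC2 _ f F) //.
- apply: continuous_in_subspaceT => x; rewrite inE /= in_itv /=; exact: cf.
- split.
  + move=> x; rewrite in_itv /= => /andP[h1 h2].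
    by have [] := dF x; rewrite ?(ltW h1) ?(ltW h2).
  + apply: cvg_at_right_filter; apply: cF; by rewrite lexx ltW.
  + apply: cvg_at_left_filter; apply: cF; by rewrite lexx ltW.
move=> x; rewrite in_itv /= => /andP[h1 h2].
by have [_ <-] := dF x ltac:(by rewrite (ltW h1) (ltW h2)); rewrite derive1E.
Qed.

End IntervalIntegrals.

(** * Integration along piecewise smooth complex paths *)

Section Paths.
Variable R : realType.
Notation mu := (@lebesgue_measure R).
Notation C := R[i].
Notation Re := (@complex.Re R).
Notation Im := (@complex.Im R).

Lemma ReD (x y : C) : Re (x + y) = Re x + Re y. Proof. by case: x y => ? ? []. Qed.
Lemma ImD (x y : C) : Im (x + y) = Im x + Im y. Proof. by case: x y => ? ? []. Qed.
Lemma ReM (x y : C) : Re (x * y) = Re x * Re y - Im x * Im y.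
Proof. by case: x y => ? ? []. Qed.
Lemma ImM (x y : C) : Im (x * y) = Re x * Im y + Im x * Re y.
Proof. by case: x y => ? ? []. Qed.
Lemma ReV (x : C) : Re x^-1 = Re x / (Re x ^+ 2 + Im x ^+ 2). Proof. by case: x. Qed.
Lemma ImV (x : C) : Im x^-1 = - (Im x / (Re x ^+ 2 + Im x ^+ 2)).
Proof. by case: x. Qed.

Lemma sqnorm_neq0 (x : C) : x != 0 -> Re x ^+ 2 + Im x ^+ 2 != 0.
Proof.
move=> x0; rewrite paddr_eq0 ?sqr_ge0 // !sqrf_eq0.
by apply: contra x0 => /andP[/eqP a /eqP b]; rewrite eq_complex a b !eqxx.
Qed.

(** Continuity, and below differentiability, of complex functions of a real variable are taken
    coordinatewise, so that the real theory applies. *)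
Definition ccont (h : R -> C) (t : R) : Prop :=
  ((fun u => Re (h u)) @ t --> Re (h t)) /\ ((fun u => Im (h u)) @ t --> Im (h t)).

Definition cderiv (h : R -> C) (t : R) (d : C) : Prop :=
  is_derive t 1 (fun u => Re (h u)) (Re d) /\ is_derive t 1 (fun u => Im (h u)) (Im d).

Lemma ccont_cst c t : ccont (fun=> c) t.
Proof. by split; exact: cvg_cst. Qed.

Lemma ccontD h k t : ccont h t -> ccont k t -> ccont (fun u => h u + k u) t.
Proof.
move=> [h1 h2] [k1 k2]; split.
  by rewrite ReD; under eq_fun do rewrite ReD; exact: cvgD.
by rewrite ImD; under eq_fun do rewrite ImD; exact: cvgD.
Qed.

Lemma ccontM h k t : ccont h t -> ccont k t -> ccont (fun u => h u * k u) t.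
Proof.
move=> [h1 h2] [k1 k2]; split.
  rewrite ReM; under eq_fun do rewrite ReM.
  by apply: cvgB; exact: cvgM.
rewrite ImM; under eq_fun do rewrite ImM.
by apply: cvgD; exact: cvgM.
Qed.

Lemma ccontV h t : h t != 0 -> ccont h t -> ccont (fun u => (h u)^-1) t.
Proof.
move=> h0 [h1 h2].
have n0 := sqnorm_neq0 h0.
have c : (fun u => (Re (h u) ^+ 2 + Im (h u) ^+ 2)^-1) @ t -->
    (Re (h t) ^+ 2 + Im (h t) ^+ 2)^-1.
  by apply: cvgV => //; apply: cvgD; exact: cvgM.
split.
  by rewrite ReV; under eq_fun do rewrite ReV; exact: cvgM.
by rewrite ImV; under eq_fun do rewrite ImV; apply: cvgN; exact: cvgM.
Qed.

Lemma cderiv_ccont h t d : cderiv h t d -> ccont h t.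
Proof.
by move=> [[h1 _] [h2 _]]; split; apply: differentiable_continuous; exact/derivable1_diffP.
Qed.

Lemma cderivM h k t d e : cderiv h t d -> cderiv k t e ->
  cderiv (fun u => h u * k u) t (h t * e + d * k t).
Proof.
move=> [h1 h2] [k1 k2]; split.
  under eq_fun do rewrite ReM.
  apply: (is_derive_eq (is_deriveB (is_deriveM h1 k1) (is_deriveM h2 k2))).
  by rewrite ReD !ReM /GRing.scale /=; ring.
under eq_fun do rewrite ImM.
apply: (is_derive_eq (is_deriveD (is_deriveM h1 k2) (is_deriveM h2 k1))).
by rewrite ImD !ImM /GRing.scale /=; ring.
Qed.

Lemma cderiv_cst c t : cderiv (fun=> c) t 0.
Proof. by split; exact: is_derive_cst. Qed.

Lemma cderivX h t d n : cderiv h t d ->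
  cderiv (fun u => h u ^+ n.+1) t (n.+1%:R * h t ^+ n * d).
Proof.
move=> hd; elim: n => [|n IH]; first by rewrite expr0 mulr1 mul1r.
rewrite (_ : _ * _ * d = h t * (n.+1%:R * h t ^+ n * d) + d * h t ^+ n.+1).
  by under eq_fun do rewrite exprS; exact: cderivM.
by rewrite -[n.+2%:R]natr1 exprS; ring.
Qed.

Lemma cderivV h t d : h t != 0 -> cderiv h t d ->
  cderiv (fun u => (h u)^-1) t (- d * (h t)^-1 ^+ 2).
Proof.
move=> h0 [h1 h2].
have n0 := sqnorm_neq0 h0.
pose N u := Re (h u) ^+ 2 + Im (h u) ^+ 2.
have dN : is_derive t 1 N (2 * Re (h t) * Re d + 2 * Im (h t) * Im d).
  apply: (is_derive_eq (is_deriveD (is_deriveM h1 h1) (is_deriveM h2 h2))).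
  by rewrite /GRing.scale /=; ring.
have dV := is_deriveV (n0 : N t != 0) dN.
split.
  under eq_fun do rewrite ReV.
  apply: (is_derive_eq (is_deriveM h1 dV)).
  rewrite expr2 !(ReM, ImM, ReV, ImV) /GRing.scale /= /N.
  move: n0; move: (Re (h t)) (Im (h t)) => a b n0.
  by case: d {h1 h2 dV dN} => x y /=; field.
under eq_fun do rewrite ImV.
apply: (is_derive_eq (is_deriveN (is_deriveM h2 dV))).
rewrite expr2 !(ReM, ImM, ReV, ImV) /GRing.scale /= /N.
move: n0; move: (Re (h t)) (Im (h t)) => a b n0.
by case: d {h1 h2 dV dN} => x y /=; field.
Qed.


(** Continuity of [f] at the points of the path, tested on arbitrary continuous curves: a smooth
    piece [h] agrees with [g] only on a closed interval, yet continuity of [f] along [h] is needed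
    at its ends too. *)
Definition path_continuous (g : R -> C) (f : C -> C) : Prop :=
  forall t, 0 <= t <= 1 -> forall h u, ccont h u -> h u = g t ->
  ccont (fun v => f (h v)) u.

Section PathContinuous.
Variable g : R -> C.
Implicit Types f k : C -> C.

Lemma path_continuous_id : path_continuous g id.
Proof. by []. Qed.

Lemma path_continuous_cst c : path_continuous g (fun=> c).
Proof. by move=> t _ h u _ _; exact: ccont_cst. Qed.

Lemma path_continuousD f k : path_continuous g f -> path_continuous g k ->
  path_continuous g (fun z => f z + k z).
Proof.
by move=> cf ck t ht h u hu e; apply: ccontD; [exact: (cf t)|exact: (ck t)].
Qed.

Lemma path_continuousM f k : path_continuous g f -> path_continuous g k ->
  path_continuous g (fun z => f z * k z).
Proof.
by move=> cf ck t ht h u hu e; apply: ccontM; [exact: (cf t)|exact: (ck t)].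
Qed.

Lemma path_continuousV f : (forall t, 0 <= t <= 1 -> f (g t) != 0) ->
  path_continuous g f -> path_continuous g (fun z => (f z)^-1).
Proof.
move=> f0 cf t ht h u hu e; apply: ccontV; last exact: (cf t).
by rewrite e f0.
Qed.

Lemma path_continuousX f n : path_continuous g f -> path_continuous g (fun z => f z ^+ n).
Proof.
move=> cf; elim: n => [|n IH]; first exact: path_continuous_cst.
under eq_fun do rewrite exprS.
exact: path_continuousM cf IH.
Qed.

Lemma path_continuous_sum (I : Type) (r : seq I) (P : pred I) (f : I -> C -> C) :
  (forall i, P i -> path_continuous g (f i)) ->
  path_continuous g (fun z => \sum_(i <- r | P i) f i z).
Proof.
move=> cf; elim: r => [|i r IH].
  by under eq_fun do rewrite big_nil; exact: path_continuous_cst.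
have [Pi|/negPf Pi] := boolP (P i); under eq_fun do rewrite big_cons Pi; last by [].
exact: (path_continuousD (cf i Pi) IH).
Qed.

Lemma path_continuous_horner (p : {poly C}) : path_continuous g (fun z => p.[z]).
Proof.
under eq_fun do rewrite horner_coef.
apply: (@path_continuous_sum _ _ _ (fun (i : 'I_(size p)) z => p`_i * z ^+ i)) => i _.
apply: (path_continuousM (f := fun=> p`_i)); first exact: path_continuous_cst.
exact/path_continuousX/path_continuous_id.
Qed.

Lemma path_continuous_subV a : off_path g a -> path_continuous g (fun z => (z - a)^-1).
Proof.
move=> ha; apply: (path_continuousV (f := fun z => z - a)) => [t ht|].
  by rewrite subr_eq0 ha.
apply: (path_continuousD (k := fun=> - a)); first exact: path_continuous_id.
exact: path_continuous_cst.
Qed.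

End PathContinuous.

Lemma path_derivP (h : R -> C) t :
  C1 (fun u => Re (h u)) -> C1 (fun u => Im (h u)) -> cderiv h t (path_deriv h t).
Proof.
by move=> [d1 _] [d2 _]; split; rewrite /path_deriv /= derive1E; exact/derivableP.
Qed.

Lemma path_deriv_eq (g h : R -> C) a b :
  (forall u, a <= u <= b -> g u = h u) ->
  {in `]a, b[, path_deriv g =1 path_deriv h}.
Proof.
move=> gh u; rewrite in_itv /= => hu.
have e (P : C -> R) : derive1 (fun u => P (g u)) u = derive1 (fun u => P (h u)) u.
  rewrite !derive1E; apply: near_eq_derive.
  near=> v; rewrite gh //.
  have : v \in `]a, b[ by near: v; apply: near_in_itvoo; rewrite in_itv.
  by rewrite in_itv /= => /andP[h1 h2]; rewrite !ltW.
by rewrite /path_deriv !e.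
Unshelve. all: by end_near. Qed.

(* [P] stands for [Re] or [Im] *)
Definition path_integrand (P : C -> R) (g : R -> C) (f : C -> C) (t : R) : R :=
  P (f (g t) * path_deriv g t).

(** Induction over the break points, reducing integrability and the fundamental theorem to one
    smooth piece. *)
Lemma piecewise_ind (g : R -> C) (Q : R -> R -> Prop) : piecewise_C1 g ->
  Q 0 0 ->
  (forall b c, 0 <= b < c -> c <= 1 -> Q 0 b -> Q b c -> Q 0 c) ->
  (forall a b (h : R -> C), 0 <= a < b -> b <= 1 ->
     C1 (fun u => Re (h u)) -> C1 (fun u => Im (h u)) ->
     (forall u, a <= u <= b -> g u = h u) -> Q a b) ->
  Q 0 1.
Proof.
move=> [n [t [t0 t1 lt_t hh]]] Q0 Qcat Qp.
have mono i j : (i <= j <= n)%N -> t i <= t j.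
  move=> /andP[ij]; elim: j ij => [|j IH]; first by rewrite leqn0 => /eqP->.
  rewrite leq_eqVlt => /orP[/eqP-> //|ij] jn.
  by rewrite (le_trans (IH ij (ltnW jn))) // ltW // lt_t.
rewrite -t1; suff : forall i, (i <= n)%N -> Q 0 (t i) by apply.
elim=> [_|i IH hi]; first by rewrite t0.
have b0 : 0 <= t i by rewrite -t0 mono //= ltnW.
have b1 : t i.+1 <= 1 by rewrite -t1 mono // leqnn andbT.
have [h [c1 c2 gh]] := hh i hi.
apply: (Qcat (t i)) => //; first by rewrite b0 lt_t.
  exact/IH/ltnW.
by apply: (Qp _ _ h) => //; rewrite b0 lt_t.
Qed.

Section PathIntegrals.
Variable g : R -> C.
Hypothesis pg : piecewise_C1 g.
Variable P : C -> R.
Hypothesis PRI : P = Re \/ P = Im.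

Lemma ccont_part h u : ccont h u -> {for u, continuous (fun v => P (h v))}.
Proof. by case: PRI => -> []. Qed.

Lemma ccont_piece f h a b : 0 <= a < b -> b <= 1 -> path_continuous g f ->
  C1 (fun u => Re (h u)) -> C1 (fun u => Im (h u)) ->
  (forall u, a <= u <= b -> g u = h u) ->
  forall u, a <= u <= b -> {for u, continuous (path_integrand P h f)}.
Proof.
move=> /andP[a0 ab] b1 cf c1 c2 gh u hu; apply: ccont_part; apply: ccontM.
  apply: (cf u); last by rewrite gh.
    by case/andP: hu => h1 h2; rewrite (le_trans a0 h1) (le_trans h2 b1).
  exact/cderiv_ccont/path_derivP.
by split; [case: c1 => _; exact | case: c2 => _; exact].
Qed.

Lemma path_integrand_eq f h a b :
  (forall u, a <= u <= b -> g u = h u) ->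
  {in `]a, b[, path_integrand P g f =1 path_integrand P h f}.
Proof.
move=> gh u hu; rewrite /path_integrand (path_deriv_eq gh hu) gh //.
by move: hu; rewrite in_itv /= => /andP[h1 h2]; rewrite !ltW.
Qed.

Lemma path_integrable f : path_continuous g f ->
  mu.-integrable `[0, 1] (EFin \o path_integrand P g f).
Proof.
move=> cf.
apply: (piecewise_ind (Q := fun a b =>
   mu.-integrable `[a, b] (EFin \o path_integrand P g f)) pg).
- apply: (@integrable_oo_cc _ _ _ _ (cst 0)); last exact: integrable0.
  by move=> x; rewrite in_itv /= => /andP[h1 h2]; have := lt_trans h1 h2; rewrite ltxx.
- by move=> b c /andP[b0 bc] _; apply: integrable_itv_cat => //; exact: ltW.
move=> a b h ha hb c1 c2 gh.
apply: integrable_oo_cc (path_integrand_eq f gh) _.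
apply: continuous_itv_integrable; exact: ccont_piece ha hb cf c1 c2 gh.
Qed.

(** The hypothesis on the primitive [F] is its chain rule along curves, which replaces complex
    differentiability and can be verified with [cderiv] alone. *)
Lemma path_FTC f F : path_continuous g f ->
  (forall t, 0 <= t <= 1 -> forall h u d, cderiv h u d -> h u = g t ->
     cderiv (fun v => F (h v)) u (f (h u) * d)) ->
  \int[mu]_(t in `[0, 1]) path_integrand P g f t = P (F (g 1)) - P (F (g 0)).
Proof.
move=> cf dF; have fi := path_integrable cf.
apply: (piecewise_ind (Q := fun a b =>
  \int[mu]_(t in `[a, b]) path_integrand P g f t = P (F (g b)) - P (F (g a))) pg).
- by rewrite set_itv1 Rintegral_set1 subrr.
- move=> b c /andP[b0 bc] c1 e1 e2; rewrite (@Rintegral_itv_cat _ _ b) ?(ltW bc) //.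
    by rewrite e1 e2 addrC addrA subrK.
  by apply: integrableS fi => //; apply: subset_itv; rewrite bnd_simp.
move=> a b h ha hb c1 c2 gh.
have cc := ccont_piece ha hb cf c1 c2 gh.
case/andP: ha => a0 ab.
rewrite (Rintegral_oo_cc (path_integrand_eq f gh)); last exact: continuous_itv_integrable.
rewrite !gh ?lexx ?ltW //.
apply: (@Rintegral_FTC _ _ _ _ (fun u => P (F (h u)))) => // u hu.
have hu1 : 0 <= u <= 1 by case/andP: hu => h1 h2; rewrite (le_trans a0 h1) (le_trans h2 hb).
have := dF u hu1 h u _ (path_derivP u c1 c2) (esym (gh _ hu)).
by rewrite /path_integrand; case: PRI => -> [].
Qed.

End PathIntegrals.

Section ContourIntegrals.
Variable g : R -> C.
Hypothesis pg : piecewise_C1 g.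
Implicit Types f k : C -> C.

Lemma contour_integralE f : contour_integral g f =
  Complex (\int[mu]_(t in `[0, 1]) path_integrand Re g f t)
          (\int[mu]_(t in `[0, 1]) path_integrand Im g f t).
Proof. by []. Qed.

Lemma eq_contour_integral f k : (forall t, 0 <= t <= 1 -> f (g t) = k (g t)) ->
  contour_integral g f = contour_integral g k.
Proof.
move=> fk; rewrite !contour_integralE; congr Complex; apply: eq_Rintegral => t;
  by rewrite inE /= in_itv /= /path_integrand => ht; rewrite fk.
Qed.

Lemma contour_integralD f k : path_continuous g f -> path_continuous g k ->
  contour_integral g (fun z => f z + k z) = contour_integral g f + contour_integral g k.
Proof.
move=> cf ck; rewrite !contour_integralE.
have h P : P = Re \/ P = Im -> {morph P : x y / x + y} ->
    \int[mu]_(t in `[0, 1]) path_integrand P g (fun z => f z + k z) t =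
    \int[mu]_(t in `[0, 1]) path_integrand P g f t +
    \int[mu]_(t in `[0, 1]) path_integrand P g k t.
  move=> PRI PD; rewrite -RintegralD //; [|exact: path_integrable..].
  by apply: eq_Rintegral => t _; rewrite /path_integrand mulrDl PD.
rewrite !h //; [by right | exact: ImD | by left | exact: ReD].
Qed.

Lemma contour_integralZ c f : path_continuous g f ->
  contour_integral g (fun z => c * f z) = c * contour_integral g f.
Proof.
move=> cf; rewrite !contour_integralE.
have iR := path_integrable pg (or_introl erefl) cf.
have iI := path_integrable pg (or_intror erefl) cf.
have iZ (r : R) P : mu.-integrable `[0, 1] (EFin \o path_integrand P g f) ->
    mu.-integrable `[0, 1] (EFin \o (fun t => r * path_integrand P g f t)).
  by move=> hi; apply: eq_integrable (integrableZl _ r hi) => // t _; rewrite /= EFinM.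
case: c => a b; rewrite [RHS]/GRing.mul /=; congr Complex.
  rewrite -!RintegralZl // -RintegralB //; [|exact: iZ..].
  by apply: eq_Rintegral => t _; rewrite /path_integrand -mulrA ReM.
rewrite -!RintegralZl // -RintegralD //; [|exact: iZ..].
by apply: eq_Rintegral => t _; rewrite /path_integrand -mulrA ImM.
Qed.

Lemma contour_integral0 : contour_integral g (fun=> 0) = 0.
Proof.
have e := @contour_integralZ 0 (fun=> 0) (@path_continuous_cst g 0).
rewrite [RHS]mul0r in e; rewrite -[RHS]e.
by apply: eq_contour_integral => t _; rewrite mul0r.
Qed.

Lemma contour_integral_sum (I : Type) (r : seq I) (Q : pred I) (f : I -> C -> C) :
  (forall i, Q i -> path_continuous g (f i)) ->
  contour_integral g (fun z => \sum_(i <- r | Q i) f i z) =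
  \sum_(i <- r | Q i) contour_integral g (f i).
Proof.
move=> cf; elim: r => [|i r IH].
  rewrite big_nil -[RHS]contour_integral0.
  by apply: eq_contour_integral => t _; rewrite big_nil.
rewrite big_cons; case: ifP => Qi.
  rewrite -IH -contour_integralD; [|exact: cf|exact: path_continuous_sum].
  by apply: eq_contour_integral => t _; rewrite big_cons Qi.
by rewrite -IH; apply: eq_contour_integral => t _; rewrite big_cons Qi.
Qed.

Hypothesis closed_g : g 0 = g 1.

Lemma contour_integral_primitive f F : path_continuous g f ->
  (forall t, 0 <= t <= 1 -> forall h u d, cderiv h u d -> h u = g t ->
     cderiv (fun v => F (h v)) u (f (h u) * d)) ->
  contour_integral g f = 0.
Proof.
move=> cf dF; rewrite contour_integralE.
by rewrite !(path_FTC pg _ cf dF) ?closed_g ?subrr; [|right|left].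
Qed.

Lemma cderivZ h t d c : cderiv h t d -> cderiv (fun u => c * h u) t (c * d).
Proof.
move=> hd; have := cderivM (cderiv_cst c t) hd.
by rewrite mul0r addr0.
Qed.

Lemma contour_integralX n : contour_integral g (fun z => z ^+ n) = 0.
Proof.
have n0 : (n.+1%:R : C) != 0 by rewrite pnatr_eq0.
apply: (contour_integral_primitive (F := fun z => n.+1%:R^-1 * z ^+ n.+1)).
  exact/path_continuousX/path_continuous_id.
move=> t ht h u d hd e.
have -> : h u ^+ n * d = n.+1%:R^-1 * (n.+1%:R * h u ^+ n * d).
  by rewrite -!mulrA mulKf.
exact/cderivZ/cderivX.
Qed.

Lemma contour_integralV n : off_path g 0 ->
  contour_integral g (fun z => z^-1 ^+ n.+2) = 0.
Proof.
move=> g0; have n0 : (n.+1%:R : C) != 0 by rewrite pnatr_eq0.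
apply: (contour_integral_primitive (F := fun z => - n.+1%:R^-1 * z^-1 ^+ n.+1)).
  apply: path_continuousX; apply: path_continuousV; first exact: g0.
  exact: path_continuous_id.
move=> t ht h u d hd e.
have -> : (h u)^-1 ^+ n.+2 * d =
    - n.+1%:R^-1 * (n.+1%:R * (h u)^-1 ^+ n * (- d * (h u)^-1 ^+ 2)).
  transitivity (n.+1%:R^-1 * n.+1%:R * ((h u)^-1 ^+ n * (h u)^-1 ^+ 2 * d)).
    by rewrite mulVf // mul1r -exprD addn2.
  move: ((h u)^-1) => w; move: (n.+1%:R^-1) => a; move: (n.+1%:R) => b; ring.
by apply/cderivZ/cderivX/cderivV => //; rewrite e g0.
Qed.

Lemma contour_integral_horner (p : {poly C}) : contour_integral g (fun z => p.[z]) = 0.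
Proof.
rewrite (eq_contour_integral (k := fun z => \sum_(i < size p) p`_i * z ^+ i)).
  rewrite contour_integral_sum => [|i _]; last first.
    apply: path_continuousM; first exact: path_continuous_cst.
    exact/path_continuousX/path_continuous_id.
  apply: big1 => i _; rewrite contour_integralZ.
    by rewrite contour_integralX mulr0.
  exact/path_continuousX/path_continuous_id.
by move=> t _; rewrite horner_coef.
Qed.

End ContourIntegrals.

End Paths.

(** Split [p] at degree [i + 1]. The high part contributes a multiple of [X - a], zero at [a]; the
    low part times [X - a] reaches degree [i + 1] only through its leading term, with coefficient
    [p_i]. *)
Lemma drop_poly_XsubC_horner (F : fieldType) (p : {poly F}) a i :
  (drop_poly i.+1 (('X - a%:P) * p)).[a] = p`_i.
Proof.
rewrite -{1}(poly_take_drop i.+1 p) mulrDr drop_polyD mulrA drop_polyMXn_id.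
rewrite hornerD [(('X - a%:P) * drop_poly i.+1 p).[a]]hornerM hornerXsubC subrr mul0r addr0.
have sz : (size (drop_poly i.+1 (('X - a%:P) * take_poly i.+1 p)) <= 1)%N.
  rewrite size_drop_poly leq_subLR addn1.
  apply: (leq_trans (size_polyMleq _ _)); rewrite size_XsubC /=.
  by rewrite ltnS size_take_poly.
rewrite (size1_polyC sz) hornerC coef_drop_poly add0n mulrBl coefB coefXM coefCM /=.
by rewrite !coef_take_poly ltnSn ltnn mulr0 subr0.
Qed.

(** * Winding numbers and residues *)

Section Residues.
Variable R : realType.
Notation C := R[i].

Lemma twopii_neq0 : twopii R != 0.
Proof. by rewrite eq_complex /= negb_and mulf_neq0 ?orbT // gt_eqF ?pi_gt0. Qed.

Lemma contour_integral_winding (g : R -> C) a :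
  contour_integral g (fun z => (z - a)^-1) = twopii R * winding g a.
Proof. by rewrite /winding mulVKf // twopii_neq0. Qed.

Section Contour.
Variable g : R -> C.
Hypotheses (pg : piecewise_C1 g) (closed_g : g 0 = g 1).

(** Divide [p] by [X - a]: the quotient integrates to 0 and the remainder [p(a)] is multiplied by
    the winding number. *)
Lemma contour_integral_cauchy (p : {poly C}) a : off_path g a ->
  contour_integral g (fun z => p.[z] / (z - a)) = twopii R * winding g a * p.[a].
Proof.
move=> ga.
pose Q := p %/ ('X - a%:P).
have e z : p.[z] = Q.[z] * (z - a) + p.[a].
  rewrite {1}(divp_eq p ('X - a%:P)) hornerD hornerM hornerXsubC.
  by rewrite modp_XsubC hornerC.
rewrite (eq_contour_integral (k := fun z => Q.[z] + p.[a] * (z - a)^-1)); last first.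
  by move=> t ht; rewrite {1}e mulrDl mulfK // subr_eq0 ga.
rewrite contour_integralD //; last first.
- apply: (path_continuousM (f := fun=> p.[a])); first exact: path_continuous_cst.
  exact: path_continuous_subV.
- exact: path_continuous_horner.
rewrite contour_integral_horner // add0r contour_integralZ //; last exact: path_continuous_subV.
by rewrite contour_integral_winding mulrC.
Qed.

(** Partial fractions: divide [S] by the product of the linear factors, then apply Lagrange
    interpolation to the remainder. *)
Lemma contour_integral_residues N (a : 'I_N -> C) (S : {poly C}) :
  injective a -> (forall r, off_path g (a r)) ->
  contour_integral g (fun z => S.[z] / \prod_r (z - a r)) =
  \sum_r S.[a r] / (nodal a r).[a r] * (twopii R * winding g (a r)).
Proof.
move=> a_inj ga.
pose L := \prod_r ('X - (a r)%:P).
have LE z : \prod_r (z - a r) = L.[z].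
  by rewrite horner_prod; apply: eq_bigr => r _; rewrite hornerXsubC.
have LN r : L = ('X - (a r)%:P) * nodal a r by rewrite /L (bigD1 r).
have L0 : L != 0 by apply/monic_neq0/monic_prod => r _; exact: monicXsubC.
pose T := S %% L.
have Ta r : T.[a r] = S.[a r].
  rewrite [in RHS](divp_eq S L) hornerD hornerM [in X in _ = X + _](LN r).
  by rewrite hornerM hornerXsubC subrr mul0r mulr0 add0r.
have szT : (size T <= N)%N.
  have szL : size L = N.+1.
    by rewrite /L -big_enum size_prod_XsubC size_enum_ord.
  by rewrite -ltnS -szL ltn_modp.
have Toff t : 0 <= t <= 1 -> S.[g t] / \prod_r (g t - a r) =
   (S %/ L).[g t] + \sum_r (S.[a r] / (nodal a r).[a r]) * (g t - a r)^-1.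
  move=> ht; rewrite LE {1}(divp_eq S L) hornerD hornerM mulrDl.
  have Lg : L.[g t] != 0.
    by rewrite -LE prodf_seq_neq0; apply/allP => r _; rewrite /= subr_eq0 ga.
  rewrite mulfK //; congr (_ + _).
  rewrite -/T {1}(lagrange_interpolation a_inj szT) horner_sum mulr_suml.
  apply: eq_bigr => r _; rewrite hornerZ Ta -mulrA; congr (_ * _).
  rewrite (LN r) hornerM hornerXsubC invfM mulrCA divff ?mulr1 //.
  by move: Lg; rewrite (LN r) hornerM mulf_eq0 negb_or => /andP[].
rewrite (eq_contour_integral (k := fun z =>
  (S %/ L).[z] + \sum_r (S.[a r] / (nodal a r).[a r]) * (z - a r)^-1)); last exact: Toff.
have cr r : path_continuous g (fun z => (S.[a r] / (nodal a r).[a r]) * (z - a r)^-1).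
  apply: (path_continuousM (f := fun=> _)); first exact: path_continuous_cst.
  exact: path_continuous_subV.
rewrite contour_integralD //; last first.
- by apply: (@path_continuous_sum _ _ _ _ _ (fun r z => (S.[a r] / (nodal a r).[a r]) * (z - a r)^-1)).
- exact: path_continuous_horner.
rewrite contour_integral_horner // add0r contour_integral_sum //.
apply: eq_bigr => r _; rewrite contour_integralZ //; last exact: path_continuous_subV.
by rewrite contour_integral_winding.
Qed.

Hypothesis g0 : inside g 0.

Lemma path_continuous_invX n : path_continuous g (fun w => w^-1 ^+ n).
Proof.
apply: path_continuousX; apply: path_continuousV; first exact: g0.1.
exact: path_continuous_id.
Qed.

(** From [1/(w (w - z)) = z^-1 (1/(w - z) - 1/w)]: the winding numbers around [z] and 0 are both 1
    and cancel. Higher powers follow by induction; for [z = 0] the integrand is a power with a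
    primitive. *)
Lemma contour_integral_principal z n : inside g z ->
  contour_integral g (fun w => w^-1 ^+ n.+1 / (w - z)) = 0.
Proof.
move=> gz; have [->|z0] := eqVneq z 0.
  rewrite -[RHS](contour_integralV pg closed_g n g0.1).
  by apply: eq_contour_integral => t _; rewrite subr0 -exprSr.
elim: n => [|n IH].
  rewrite (eq_contour_integral (k := fun w => z^-1 * (w - z)^-1 + (- z^-1) * w^-1 ^+ 1)).
    rewrite contour_integralD //; last first.
    - apply: (path_continuousM (f := fun=> _)); first exact: path_continuous_cst.
      exact: path_continuous_invX.
    - apply: (path_continuousM (f := fun=> _)); first exact: path_continuous_cst.
      exact: path_continuous_subV gz.1.
    rewrite !contour_integralZ //; [|exact: path_continuous_invX|exact: path_continuous_subV gz.1].
    rewrite [contour_integral g (fun w => w^-1 ^+ 1)](_ : _ = twopii R * winding g 0).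
      by rewrite contour_integral_winding gz.2 g0.2 mulNr subrr.
    rewrite -contour_integral_winding.
    by apply: eq_contour_integral => t _; rewrite subr0.
  move=> t ht; have h1 : g t != 0 by exact: g0.1.
  have h2 : g t - z != 0 by rewrite subr_eq0 gz.1.
  by rewrite expr1; field; apply/and3P.
rewrite (eq_contour_integral
  (k := fun w => z^-1 * (w^-1 ^+ n.+1 / (w - z)) + (- z^-1) * w^-1 ^+ n.+2)).
  have cn : path_continuous g (fun w => w^-1 ^+ n.+1 / (w - z)).
    by apply: path_continuousM; [exact: path_continuous_invX | exact: path_continuous_subV gz.1].
  rewrite contour_integralD //; last first.
  - apply: (path_continuousM (f := fun=> _)); first exact: path_continuous_cst.
    exact: path_continuous_invX.
  - by apply: (path_continuousM (f := fun=> _)); first exact: path_continuous_cst.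
  rewrite !contour_integralZ //; last exact: path_continuous_invX.
  by rewrite IH contour_integralV ?mulr0 ?addr0 //; exact: g0.1.
move=> t ht; have h1 : g t != 0 by exact: g0.1.
have h2 : g t - z != 0 by rewrite subr_eq0 gz.1.
by rewrite !exprVn !exprS; field; rewrite h1 h2 z0 expf_neq0.
Qed.

(* The integral extracts the part of [w^-(i+1) p(w)] that is polynomial in [w]. *)
Lemma contour_integral_polynomial_part (p : {poly C}) z i : inside g z ->
  contour_integral g (fun w => w^-1 ^+ i.+1 * p.[w] / (w - z)) =
  twopii R * (drop_poly i.+1 p).[z].
Proof.
move=> gz; pose D := drop_poly i.+1 p.
have cS := path_continuous_subV gz.1.
have cP n : path_continuous g (fun w => w^-1 ^+ n.+1 / (w - z)).
  by apply: path_continuousM; first exact: path_continuous_invX.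
have cc (k : 'I_i.+1) : path_continuous g (fun w => p`_k * (w^-1 ^+ (i - k).+1 / (w - z))).
  by apply: (path_continuousM (f := fun=> _)); first exact: path_continuous_cst.
(* The coefficients of [p] up to degree [i] yield principal parts, which integrate to 0; the rest is
   the polynomial [D]. *)
rewrite (eq_contour_integral (k := fun w =>
  \sum_(k < i.+1) p`_k * (w^-1 ^+ (i - k).+1 / (w - z)) + D.[w] / (w - z))); last first.
  move=> t ht; have h1 : g t != 0 by exact: g0.1.
  rewrite -{1}(poly_take_drop i.+1 p) hornerD hornerM hornerXn -/D mulrDr mulrDl.
  congr (_ + _); last first.
    by rewrite mulrCA mulrA -mulrA -exprMn mulVf // expr1n mulr1.
  rewrite (horner_coef_wide _ (size_take_poly _ _)) mulr_sumr mulr_suml.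
  apply: eq_bigr => k _; rewrite coef_take_poly ltn_ord.
  rewrite mulrCA mulrAC -mulrA; congr (_ * _); rewrite mulrC; congr (_ / _).
  have e : i.+1 = ((i - k).+1 + k)%N by have := ltn_ord k; lia.
  by rewrite [X in _ ^+ X * _]e exprD -mulrA -exprMn mulVf // expr1n mulr1.
rewrite contour_integralD //; last first.
- by apply: path_continuousM; first exact: path_continuous_horner.
- exact: (@path_continuous_sum _ _ _ _ _ (fun (k : 'I_i.+1) w => p`_k * (w^-1 ^+ (i - k).+1 / (w - z)))).
rewrite contour_integral_cauchy; last exact: gz.1.
rewrite gz.2 mulr1 contour_integral_sum // big1 ?add0r // => k _.
by rewrite contour_integralZ // contour_integral_principal // mulr0.
Qed.

End Contour.
End Residues.

(** * The correlation kernel *)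

Section ContourKernel.
Variables (R : realType) (q : R) (N : nat) (nu : N.-tuple int).
Hypotheses (hq : 0 < q < 1) (hnu : sorted >=%R nu).
Notation C := R[i].
Let Q : C := q%:C%C.

Lemma base_neq0 : Q != 0.
Proof. by rewrite /Q eq_complex /= eqxx andbT gt_eqF //; case/andP: hq. Qed.

Lemma base_not_root k : (0 < k)%N -> 1 - Q ^+ k != 0.
Proof.
move=> k0; rewrite subr_eq0 eq_sym /Q -rmorphXn /= eq_complex /= eqxx andbT.
by case/andP: hq => h0 h1; rewrite lt_eqF // exprn_ilt1 // -?lt0n // ltW.
Qed.

Lemma phi21E n1 y : phi21 n1 Q^-1 (Q ^+ (n1 - 1)) (Q ^+ (N - 1)) Q^-1 y =
  \sum_(i < n1) phi_coef Q N n1 i * y ^+ i.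
Proof. by apply: eq_bigr => i _; rewrite /phi_coef mulrCA mulrC -!mulrA. Qed.

Let qpoly (c : C) (m : nat) : {poly C} := \prod_(i < m) (1 - (c * Q ^+ i) *: 'X).

Let qpolyE c m z : (qpoly c m).[z] = qpoch (z * c) Q m.
Proof.
rewrite horner_prod; apply: eq_bigr => i _.
by rewrite hornerD hornerN hornerZ hornerX hornerC mulrC mulrA.
Qed.

Lemma top_le r : (r < N)%N -> nu`_r <= nu`_0.
Proof.
move=> hr; have := sorted_leq_nth (@ge_trans _ int) (@ge_refl _ int) 0 hnu.
by apply; rewrite ?inE ?size_tuple // (leq_trans _ hr).
Qed.

Lemma qkernelE x1 n1 x2 n2 (gz gw : R -> C) : (1 <= n1 <= N)%N ->
  admissible_contours q nu`_0 x1 x2 gz gw ->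
  qkernel q nu x1 n1 x2 n2 gz gw = residue_kernel Q N nu x1 n1 x2 n2.
Proof.
move=> hn1 [[[pz cz _ _] [pw cw _ _]] zin zout win w0].
have q0 := base_neq0; have q1 := base_not_root.
pose a (r : 'I_N) := node Q nu x1 r.
have aE (r : 'I_N) : Q ^ (tnth nu r - r.+1%:Z - x1) = a r.
  by rewrite /a /node (tnth_nth 0).
have a_inj : injective a by apply: node_inj; rewrite ?size_tuple.
(* Every node is a power of [q] with exponent at most [nu_1 - 1 - x1], so the hypotheses on the
   contour decide its winding number. *)
have az (r : 'I_N) : off_path gz (a r) /\
    winding gz (a r) = (if x2 <= nu`_r - r.+1%:Z then 1 else 0).
  have := top_le (ltn_ord r) => hr.
  case: ifP => h.
    by apply: zin; rewrite lerD2r h /= lerD2r; move: hr; move: (nu`_r) (nu`_0) => u v; lia.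
  by apply: zout; rewrite ltrD2r ltNge h.
pose L := \prod_r ('X - (a r)%:P).
pose c := Q ^ (n2%:Z * (x1 - x2)).
pose m := (N - n2 - 1)%N.
(* Numerator left by the integral in [w]. It carries one factor [twopii]; the residues in [z] supply
   the other. *)
pose S : {poly C} := twopii R *: ((c / qpoch Q Q m) *:
  ('X^n2 * qpoly (Q ^ (1 - x2 + x1)) m *
   \sum_(i < n1) phi_coef Q N n1 i *: drop_poly i.+1 L)).
rewrite /qkernel /residue_kernel -/Q; congr (_ + _).
have inner t : 0 <= t <= 1 ->
    contour_integral gw (fun w => kernel_integrand q nu x1 n1 x2 n2 (gz t) w) =
    S.[gz t] / \prod_r (gz t - a r).
  move=> ht; have gzt := win t ht.
  (* Everything in the integrand that does not depend on [w], apart from the series coefficients. *)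
  pose D := c * gz t ^+ n2 * (qpoch (gz t * Q ^ (1 - x2 + x1)) Q m / qpoch Q Q m) /
            \prod_r (gz t - a r).
  rewrite (eq_contour_integral (k := fun w =>
    \sum_(i < n1) (D * phi_coef Q N n1 i) * (w^-1 ^+ i.+1 * L.[w] / (w - gz t)))).
    have ci (i : 'I_n1) : path_continuous gw (fun w => w^-1 ^+ i.+1 * L.[w] / (w - gz t)).
      apply: path_continuousM; last exact: path_continuous_subV gzt.1.
      apply: path_continuousM; last exact: path_continuous_horner.
      exact: path_continuous_invX.
    rewrite contour_integral_sum // => [|i _]; last first.
      by apply: (path_continuousM (f := fun=> _)); first exact: path_continuous_cst.
    transitivity (\sum_(i < n1) D * phi_coef Q N n1 i *
                    (twopii R * (drop_poly i.+1 L).[gz t])).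
      apply: eq_bigr => i _; rewrite contour_integralZ //.
      by rewrite contour_integral_polynomial_part.
    rewrite /S !hornerZ !hornerM hornerXn qpolyE horner_sum.
    transitivity (D * twopii R * \sum_(i < n1) phi_coef Q N n1 i * (drop_poly i.+1 L).[gz t]).
      by rewrite mulr_sumr; apply: eq_bigr => i _; rewrite mulrACA mulrA.
    have -> : \sum_(i < n1) (phi_coef Q N n1 i *: drop_poly i.+1 L).[gz t] =
        \sum_(i < n1) phi_coef Q N n1 i * (drop_poly i.+1 L).[gz t].
      by apply: eq_bigr => i _; rewrite hornerZ.
    rewrite /D; move: (\sum_(i < n1) _) (qpoch _ _ _) ((qpoch _ _ _)^-1) => s p pi.
    by move: ((\prod_r _)^-1) (gz t ^+ n2) (twopii R) => l g1 tp; ring.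
  move=> u hu; rewrite /kernel_integrand -/Q phi21E prodf_div.
  rewrite -/c -/m.
  have -> : \prod_(r < N) (gw u - Q ^ (tnth nu r - r.+1%:Z - x1)) = L.[gw u].
    by rewrite horner_prod; apply: eq_bigr => r _; rewrite hornerXsubC aE.
  have -> : \prod_(r < N) (gz t - Q ^ (tnth nu r - r.+1%:Z - x1)) = \prod_r (gz t - a r).
    by apply: eq_bigr => r _; rewrite aE.
  transitivity (D * ((gw u)^-1 * (\sum_(i < n1) phi_coef Q N n1 i * (gw u)^-1 ^+ i)
     * L.[gw u] / (gw u - gz t))).
    rewrite /D; move: (\sum_(i < n1) _) (qpoch _ _ _) ((qpoch _ _ _)^-1) => s p pi.
    move: ((\prod_r _)^-1) (gz t ^+ n2) (L.[_]) => l g1 Lw.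
    by move: ((_ - _)^-1) ((gw u)^-1) => dw iw; ring.
  rewrite [(gw u)^-1 * _]mulr_sumr !mulr_suml mulr_sumr; apply: eq_bigr => i _.
  by rewrite exprS; move: ((_ - _)^-1) (_^-1) => dw iw; ring.
rewrite (eq_contour_integral (k := fun z => S.[z] / \prod_r (z - a r))); last exact: inner.
rewrite contour_integral_residues //; last first.
  by move=> r; case: (az r).
rewrite -!mulrA; congr (_ * _); rewrite mulr_sumr [RHS]big_mkcond; apply: eq_bigr => r _ /=.
have -> : winding gz (a r) = (if x2 <= nu`_r - r.+1%:Z then 1 else 0) by case: (az r).
case: ifP => h; last by rewrite !mulr0.
rewrite /S !hornerZ !hornerM hornerXn qpolyE horner_sum.
have -> : \sum_(i < n1) (phi_coef Q N n1 i *: drop_poly i.+1 L).[a r] =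
   \sum_(i < n1) phi_coef Q N n1 i * (nodal a r)`_i.
  apply: eq_bigr => i _; rewrite hornerZ; congr (_ * _).
  by rewrite -(drop_poly_XsubC_horner _ (a r)) /L (bigD1 r).
rewrite -/a -/m -/c mulr1.
have tp := twopii_neq0 R; have n0 := nodal_neq0 a_inj r.
have m0 := qpochqq_neq0 q1 m.
by field; apply/and3P.
Qed.

End ContourKernel.

(** * The measure on schemes and its correlation functions *)

Lemma weightE (R : realType) (q : R) (N : nat) (nu : N.-tuple int) :
  0 < q < 1 -> (0 < N)%N -> exists2 c : R[i], c != 0 &
    forall a, GT_scheme nu a -> (weight q a)%:C%C = c * particle_weight q%:C%C a.
Proof.
move=> hq hN; have q0 := base_neq0 hq.
(* Positions differ from parts by the shifts [j], whose total is the same for all schemes. *)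
pose e : int := - \sum_(m < N) \sum_(j < m) j.+1%:Z.
exists (q%:C%C ^ e); first exact: expfz_neq0.
move=> a [h1 _ _].
have -> : particle_weight q%:C%C a =
    q%:C%C ^ (- \sum_(m < N) \sum_(j < m) ((level a m)`_j - j.+1%:Z)).
  rewrite /particle_weight -sumrN.
  rewrite (big_morph _ (fun x y => expfzDr x y q0) (expr0z _)).
  apply: eq_bigr => m _; rewrite -sumrN.
  by rewrite (big_morph _ (fun x y => expfzDr x y q0) (expr0z _)).
rewrite /weight -expfzDr // (fmorphXz (real_complex R)); congr (_ ^ _).
rewrite /e -opprD; congr (- _).
rewrite -big_split /=.
have -> : vol a = \sum_(m < N) \sum_(j < m) (level a m)`_j.
  rewrite /vol -(big_mkord xpredT (fun m => \sum_(j < m) (level a m)`_j)).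
  rewrite [RHS]big_ltn // big_ord0 add0r; apply: eq_big_nat => m hm.
  have [sz _] := h1 m ltac:(by case/andP: hm => -> /ltnW).
  by rewrite (big_nth 0) sz big_mkord.
apply: eq_bigr => m _; rewrite -big_split /=.
by apply: eq_bigr => j _; rewrite addrC subrK.
Qed.

Lemma qprobE (R : realType) (q : R) (N : nat) (nu : N.-tuple int) (E : set (array N)) :
  0 < q < 1 -> (0 < N)%N -> sorted >=%R nu ->
  (qprob q nu E)%:C%C =
  (\sum_(a <- schemes N nu | `[< E a >]) particle_weight q%:C%C a) /
  (\sum_(a <- schemes N nu) particle_weight q%:C%C a).
Proof.
move=> hq hN hnu.
have GT := GT_schemeE hN hnu.
have un : uniq (schemes N nu) by apply: schemes_uniq; rewrite ?size_tuple.
have [c c0 wE] := weightE nu hq hN.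
have full : \sum_(a \in GT_scheme nu) weight q a = \sum_(a <- schemes N nu) weight q a.
  by rewrite GT -fsbig_seq.
have part : \sum_(a \in GT_scheme nu `&` E) weight q a =
    \sum_(a <- schemes N nu | `[< E a >]) weight q a.
  rewrite fsbig_mkcondr GT -fsbig_seq // [RHS]big_mkcond /=.
  by apply: eq_bigr => a _.
have -> : qprob q nu E = (\sum_(a <- schemes N nu | `[< E a >]) weight q a) /
    \sum_(a <- schemes N nu) weight q a.
  by rewrite /qprob; congr (_ / _); [exact: part | exact: full].
have cast (P : pred (array N)) : ((\sum_(a <- schemes N nu | P a) weight q a)%:C)%C =
    c * \sum_(a <- schemes N nu | P a) particle_weight q%:C%C a.
  rewrite (rmorph_sum (real_complex R)) mulr_sumr big_seq_cond [RHS]big_seq_cond.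
  by apply: eq_bigr => a /andP[ha _]; apply: wE; rewrite GT.
rewrite (rmorphM (real_complex R)) (fmorphV (real_complex R)) /= !cast.
by rewrite invfM mulrACA divff // mul1r.
Qed.

Theorem theorem4p1 (R : realType) (q : R) (N : nat) (nu : N.-tuple int)
    (hq : 0 < q < 1) (hN : (0 < N)%N) (hnu : sorted >=%R nu)
    (* a choice of contours for each (x1, n1, x2, n2) *)
    (gz gw : int -> nat -> int -> nat -> R -> R[i])
    (hg : forall (x1 : int) (n1 : nat) (x2 : int) (n2 : nat),
       (1 <= n1 <= N)%N -> (1 <= n2 <= N - 1)%N ->
       admissible_contours q (nu`_0) x1 x2 (gz x1 n1 x2 n2) (gw x1 n1 x2 n2)) :
  correlation_kernel q nu (fun x1 n1 x2 n2 =>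
    qkernel q nu x1 n1 x2 n2 (gz x1 n1 x2 n2) (gw x1 n1 x2 n2)).
Proof.
move=> s x n inj hn.
have q0 := base_neq0 hq; have q1 := base_not_root hq.
have sz := size_tuple nu.
rewrite qprobE // (sum_schemes_occupied q0 q1 sz hnu hn inj).
rewrite (partition_weight q0 q1 x sz hnu hn) mulrAC divff ?det_top_psi_neq0 // mul1r.
(* Transposition compensates the reversed order of indices in [residue_kernelE]. *)
rewrite -det_tr; apply/esym.
apply: (det_conj (d := fun i => q%:C%C ^ ((n i - 1)%:Z * x i))).
  by move=> i; rewrite unitfE expfz_neq0.
move=> i j; rewrite mxE qkernelE //.
- by rewrite (residue_kernelE q0 q1 x sz hnu hn) [_^T _ _]mxE.
- by have := hn i; lia.
by apply: hg; [have := hn i; lia | exact: hn].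
Qed.
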